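(* Given any frequency vector $\omega\in\mathcal{D}(\rho,\alpha)$, for each $u\in C(\mathbb{T}^n,\mathbb{R})$, there is a constant $\tilde{K}>0$ such that \[ \|\tilde{T}^a_tu-\bar{u}\|_\infty\leq \tilde{K}\,t^{-(1+\frac{4}{2\rho+n})}, \quad \forall t>0, \] where $\bar u=\lim_{t\to+\infty}T^a_tu$ and $\tilde{K}$ depends only on $n$, $\rho$, $\alpha$ and $u$.
   Context: $\mathbb{T}^n=\mathbb{R}^n/\mathbb{Z}^n$ is the flat torus and $\mathbb{S}^{n-1}$ the unit sphere in $\mathbb{R}^n$. For $\rho>n-1$ and $\alpha>0$, the set of Diophantine vectors is \[ \mathcal{D}(\rho,\alpha)=\Big\{\beta\in\mathbb{S}^{n-1}\ :\ |\langle\beta,k\rangle|\ge\frac{\alpha}{|k|^\rho}\ \ \forall k\in\mathbb{Z}^n\setminus\{0\}\Big\},\qquad |k|=\sum_{i=1}^n|k_i|. \] Consider the $C^2$ Lagrangian \[ L^1_a(x,v)=\tfrac12\langle A(x)(v-\omega),(v-\omega)\rangle+f(x,v-\omega),\quad x\in\mathbb{T}^n,\ v\in\mathbb{R}^n, \] where $A(x)$ is an $n\times n$ matrix, $\omega\in\mathbb{S}^{n-1}$ is a given vector, and $f(x,v-\omega)=O(\|v-\omega\|^3)$ as $v-\omega\to0$. It is assumed that $L^1_a$ is positive definite (the Hessian $\partial^2L^1_a/\partial v^2(x,v)$ is positive definite for every $(x,v)$) and superlinear ($L^1_a(x,v)/\|v\|\to+\infty$ as $\|v\|\to+\infty$ uniformly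 in $x$). The data $A$ and $f$ are fixed, so the dependence of the constant on them is not tracked. The Mañé critical value satisfies $c(L^1_a)=0$. The Lax-Oleinik semigroup is, for $u\in C(\mathbb{T}^n,\mathbb{R})$, $t\ge0$, $x\in\mathbb{T}^n$, \[ T^a_tu(x)=\inf_\gamma\Big\{u(\gamma(0))+\int_0^tL^1_a(\gamma(s),\dot\gamma(s))\,ds\Big\}, \] the infimum over continuous and piecewise $C^1$ paths $\gamma:[0,t]\to\mathbb{T}^n$ with $\gamma(t)=x$. For every $u\in C(\mathbb{T}^n,\mathbb{R})$ the uniform limit $\bar u=\lim_{t\to+\infty}T^a_tu$ exists (Fathi). The new Lax-Oleinik semigroup is \[ \tilde T^a_tu(x)=\inf_{t\le\sigma\le2t}\ \inf_\gamma\Big\{u(\gamma(0))+\int_0^\sigma L^1_a(\gamma(s),\dot\gamma(s))\,ds\Big\}, \] the second infimum over continuous and piecewise $C^1$ paths $\gamma:[0,\sigma]\to\mathbb{T}^n$ with $\gamma(\sigma)=x$. $\|\cdot\|_\infty$ is the supremum norm. *)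

(* Defs.v *)
From HB Require Import structures.
From mathcomp Require Import all_boot all_order all_algebra.
From mathcomp Require Import all_classical all_reals all_analysis.

Set Implicit Arguments.
Unset Strict Implicit.
Unset Printing Implicit Defensive.

Import Order.TTheory GRing.Theory Num.Theory.
Import numFieldNormedType.Exports.

Local Open Scope classical_set_scope.
Local Open Scope ring_scope.

(* The library norm on 'cV[R]_n is the maximum norm, hence a separate
   Euclidean norm. *)
Definition dot (R : realType) (n : nat) (v w : 'cV[R]_n) : R :=
  \sum_(i < n) v i 0 * w i 0.

Definition enorm (R : realType) (n : nat) (v : 'cV[R]_n) : R :=
  Num.sqrt (dot v v).

Definition intvec (R : realType) (n : nat) (k : 'cV[int]_n) : 'cV[R]_n :=
  map_mx intr k.

Definition l1norm (R : realType) (n : nat) (k : 'cV[R]_n) : R :=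
  \sum_(i < n) `|k i 0|.

Definition sphere (R : realType) (n : nat) : set 'cV[R]_n :=
  [set v | enorm v = 1].
Arguments sphere : clear implicits.

Definition Diophantine (R : realType) (n : nat) (rho alpha : R) :
    set 'cV[R]_n :=
  [set b | sphere R n b /\ forall k : 'cV[int]_n, k != 0 ->
     alpha / l1norm (intvec R k) `^ rho <= `|dot b (intvec R k)|].
Arguments Diophantine {R} n rho alpha.

(* Maps on the torus R^n / Z^n are represented by Z^n-periodic maps on R^n. *)
Definition Zperiodic (R : realType) (n : nat) (V : zmodType)
    (g : 'cV[R]_n -> V) : Prop :=
  forall k : 'cV[int]_n, periodic g (intvec R k).

Definition C1 (R : realType) (V : normedModType R) (F : V -> R) : Prop :=
  (forall z, differentiable F z) /\ (forall e, continuous ('D_e F)).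

Definition C2 (R : realType) (V : normedModType R) (F : V -> R) : Prop :=
  C1 F /\ forall e, C1 ('D_e F).

Definition hessian (R : realType) (n : nat) (F : 'cV[R]_n -> R)
    (v : 'cV[R]_n) : 'M[R]_n :=
  \matrix_(i, j) 'D_(delta_mx j 0) ('D_(delta_mx i 0) F) v.

Definition posdef (R : realType) (n : nat) (H : 'M[R]_n) : Prop :=
  forall xi : 'cV[R]_n, xi != 0 -> 0 < dot (H *m xi) xi.

Definition positive_definite (R : realType) (n : nat)
    (L : 'cV[R]_n -> 'cV[R]_n -> R) : Prop :=
  forall x v, posdef (hessian (L x) v).

Definition superlinear (R : realType) (n : nat)
    (L : 'cV[R]_n -> 'cV[R]_n -> R) : Prop :=
  forall M : R, exists r : R, forall x v, r < enorm v -> M < L x v / enorm v.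

Definition lagrangian (R : realType) (n : nat) (A : 'cV[R]_n -> 'M[R]_n)
    (f : 'cV[R]_n -> 'cV[R]_n -> R) (omega x v : 'cV[R]_n) : R :=
  2^-1 * dot (A x *m (v - omega)) (v - omega) + f x (v - omega).

(* A map is C^1 on the closed interval [a, b] iff it is the restriction to
   [a, b] of a C^1 map defined on the whole line. *)
Definition C1_curve (R : realType) (n : nat) (a b : R)
    (g : R -> 'cV[R]_n) : Prop :=
  exists h : R -> 'cV[R]_n,
    [/\ forall s, derivable h s 1, continuous (derive1 h) &
        {in `[a, b], g =1 h}].

Definition piecewise_C1 (R : realType) (n : nat) (a b : R)
    (g : R -> 'cV[R]_n) : Prop :=
  exists2 s : seq R, itv_partition a b s &
    forall i, (i < size s)%N -> C1_curve (nth a (a :: s) i) (nth a s i) g.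

(* Paths in the torus are represented by their lifts to R^n: a continuous
   path ending at the class of x has exactly one continuous lift ending at
   the representative x.  Only the values of g on [0, t] matter. *)
Definition admissible (R : realType) (n : nat) (t : R) (x : 'cV[R]_n) :
    set (R -> 'cV[R]_n) :=
  [set g | [/\ {within `[0, t], continuous g}, piecewise_C1 0 t g & g t = x]].

(* The derivative of g may fail to exist at the finitely many break points,
   which form a null set. *)
Definition action (R : realType) (n : nat) (L : 'cV[R]_n -> 'cV[R]_n -> R)
    (t : R) (g : R -> 'cV[R]_n) : R :=
  \int[lebesgue_measure]_(s in `[0, t]) L (g s) (derive1 g s).

Definition LaxOleinik (R : realType) (n : nat)
    (L : 'cV[R]_n -> 'cV[R]_n -> R) (u : 'cV[R]_n -> R) (t : R)
    (x : 'cV[R]_n) : R :=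
  inf [set u (g 0) + action L t g | g in admissible t x].

Definition newLaxOleinik (R : realType) (n : nat)
    (L : 'cV[R]_n -> 'cV[R]_n -> R) (u : 'cV[R]_n -> R) (t : R)
    (x : 'cV[R]_n) : R :=
  inf [set inf [set u (g 0) + action L sigma g | g in admissible sigma x]
      | sigma in `[t, 2 * t]].

(* The library's [lim] needs a default point, which the space {uniform _ -> _}
   lacks, hence [get], as in the definition of [lim]. *)
Definition ubar (R : realType) (n : nat) (L : 'cV[R]_n -> 'cV[R]_n -> R)
    (u : 'cV[R]_n -> R) : 'cV[R]_n -> R :=
  get (fun ub : 'cV[R]_n -> R =>
    {uniform, LaxOleinik L u t @[t --> +oo] --> ub}).

(* Extended-real valued, so that the supremum is +oo for an unbounded g. *)
Definition supnorm (R : realType) (n : nat) (g : 'cV[R]_n -> R) : \bar R :=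
  ereal_sup [set `|g x|%:E | x in setT].

(* Main.v *)
Require Import Defs.
From HB Require Import structures.
From mathcomp Require Import all_boot all_order all_algebra.
From mathcomp Require Import ring lra zify.
From mathcomp Require Import all_classical all_reals all_analysis.

(* The Lagrangian is l(x, v - omega), where l(x, .) is convex and vanishes to
   second order at 0; hence l >= 0, and l(x, w) = O(|w|^2) uniformly in x for
   bounded w. So every path costs at least min u, while the straight path of
   duration s from a lift of a minimum point y of u to x costs at most
   min u + C |delta|^2 / s, where delta = x - y - k - s omega with k integral.
   Rounding gives |delta| = O(1) for every s, hence ubar = min u; choosing s in
   [t, 2t] gives the rate, once the orbit of the linear flow during time t is
   known to be O(t^(-2/(2 rho + n)))-dense.

   The density is a large sieve argument. For coefficients a_m supported on a
   box of side 3q let P(x) be the trigonometric polynomial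
   sum_m a_m e^(2 i pi <m, x>). The Diophantine condition separates the
   frequencies <m, omega> by a multiple of q^(-rho), so by Schur's test the
   (triangularly weighted) mean of |P|^2 along an orbit of length of order q^rho
   is comparable to sum_m a_m^2. Multiplying P by e^(2 i pi x_k) - 1 differences
   a in the direction k, which divides sum_m a_m^2 by q^2 when a is a product of
   tent functions. Hence at some time of the orbit all the 1 - cos(2 pi x_k) are
   O(q^(-2)), that is, the orbit is O(1/q)-close to any given point. *)

Import Order.TTheory GRing.Theory Num.Theory.
Import numFieldNormedType.Exports.

Local Open Scope classical_set_scope.
Local Open Scope ring_scope.

Set Implicit Arguments.
Unset Strict Implicit.
Unset Printing Implicit Defensive.

(** * Separated frequencies *)

(** A telescoping sum: [1 / y^2] is at most [1 / (y^2 - d^2 / 4)], which is the difference of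
    [1 / (d (y - d/2))] and [1 / (d (y + d/2))], and a gap of [d] gives [y - d/2 >= x0 + d/2]. *)
Lemma sum_inv_sq_path (R : realFieldType) (d x0 : R) (s : seq R) :
  0 < d -> 0 <= x0 -> path (fun x y => x + d <= y) x0 s ->
  \sum_(y <- s) (y ^+ 2)^-1 <= (d * (x0 + d / 2))^-1.
Proof.
move=> d0; elim: s x0 => [|y s IH] x0 x00 /=.
  by move=> _; rewrite big_nil invr_ge0 mulr_ge0; lra.
move=> /andP[x0y ps]; have y0 : 0 <= y by lra.
rewrite big_cons.
have key : (y ^+ 2)^-1 + (d * (y + d / 2))^-1 <= (d * (y - d / 2))^-1.
  have y1 : 0 < y by lra.
  have y2 : 0 < y - d / 2 by lra.
  have y3 : 0 < y + d / 2 by lra.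
  have -> : (d * (y - d / 2))^-1 =
      (y ^+ 2 - (d / 2) ^+ 2)^-1 + (d * (y + d / 2))^-1.
    by field; rewrite ?gt_eqF//=; nra.
  rewrite lerD2r lef_pV2 ?posrE; nra.
apply: (le_trans (lerD (lexx _) (IH _ y0 ps))); apply: (le_trans key).
by rewrite lef_pV2 ?posrE ?ler_pM2l ?mulr_gt0//; lra.
Qed.

(** Sorting the values turns pairwise separation into consecutive gaps of at least [d]; the lower
    bound [d] on the values is the first gap, counted from 0. *)
Lemma sum_inv_sq_pos (R : realFieldType) (I : finType) (P : pred I)
    (v : I -> R) (d : R) : 0 < d -> (forall i, P i -> d <= v i) ->
  (forall i j, P i -> P j -> i != j -> d <= `|v i - v j|) ->
  \sum_(i | P i) (v i ^+ 2)^-1 <= 2 / d ^+ 2.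
Proof.
move=> d0 vd vsep; pose s := sort (relpre v <=%R) (enum P).
have sP : all P s by rewrite all_sort; apply/allP => i; rewrite mem_enum.
have us : uniq s by rewrite sort_uniq enum_uniq.
have : sorted (relpre v <=%R) s.
  by apply: sort_sorted => i j /=; exact: le_total.
rewrite (sorted_pairwise (fun _ _ _ => @le_trans _ _ _ _ _)) => pw.
have pw' : pairwise (relpre v (fun x y => x + d <= y)) s.
  move: us; rewrite uniq_pairwise => pu.
  have : pairwise [rel x y | relpre v <=%R x y && (x != y)] s.
    by rewrite pairwise_relI pw.
  apply: sub_in_pairwise sP => i j Pi Pj /= /andP[vij ij].
  by have := vsep i j Pi Pj ij; rewrite ler0_norm; lra.
have -> : \sum_(i | P i) (v i ^+ 2)^-1 = \sum_(y <- map v s) (y ^+ 2)^-1.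
  rewrite big_map -big_enum /=.
  by apply: perm_big; rewrite perm_sym perm_sort.
have -> : 2 / d ^+ 2 = (d * (0 + d / 2))^-1 by field; rewrite gt_eqF.
apply: sum_inv_sq_path => //.
have := pairwise_sorted pw'; rewrite -sorted_map.
case: (s) sP => [//|i t] /= /andP[Pi _] ->.
by rewrite andbT add0r vd.
Qed.

(** The points above [v i0] and those below it contribute at most [2 / d ^+ 2] each. *)
Lemma sum_inv_sq_sep (R : realFieldType) (I : finType) (v : I -> R) (d : R)
    (i0 : I) : 0 < d -> (forall i j, i != j -> d <= `|v i - v j|) ->
  \sum_(i | i != i0) ((v i0 - v i) ^+ 2)^-1 <= 4 / d ^+ 2.
Proof.
move=> d0 vsep; rewrite (bigID (fun i => v i0 < v i)) /=.
have -> : 4 / d ^+ 2 = 2 / d ^+ 2 + 2 / d ^+ 2 :> R.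
  by field; rewrite gt_eqF.
apply: lerD.
- under eq_bigr do rewrite -sqrrN opprB.
  apply: sum_inv_sq_pos => // [i /andP[ii0 lti]|i j _ _ ij].
    by have := vsep _ _ ii0; rewrite gtr0_norm// subr_gt0.
  by have := vsep _ _ ij; rewrite opprB addrA subrK.
- apply: sum_inv_sq_pos => // [i /andP[ii0 lti]|i j _ _ ij].
    by have := vsep _ _ ii0; rewrite -leNgt in lti; rewrite ler0_norm ?subr_le0 ?opprB.
  have := vsep _ _ ij; rewrite -normrN opprB opprD opprK addrA addrAC addrC.
  by congr (_ <= `| _|); ring.
Qed.

(** The inequality [2 |a_i| |a_j| <= a_i^2 + a_j^2] splits the form into two halves, which the
    symmetry of [c] makes equal; each is then bounded by row sums. *)
Lemma schur_test (R : realFieldType) (I : finType) (a : I -> R)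
    (c : I -> I -> R) (k : R) : (forall i j, c i j = c j i) ->
  (forall i j, 0 <= c i j) ->
  (forall i, \sum_(j | j != i) c i j <= k) ->
  \sum_i \sum_(j | j != i) `|a i| * `|a j| * c i j <= k * \sum_i a i ^+ 2.
Proof.
move=> csym c0 ck.
have half : \sum_i \sum_(j | j != i) a i ^+ 2 * c i j <= k * \sum_i a i ^+ 2.
  rewrite mulr_sumr; apply: ler_sum => i _.
  by rewrite -mulr_sumr mulrC ler_wpM2r ?sqr_ge0.
have half' : \sum_i \sum_(j | j != i) a j ^+ 2 * c i j =
             \sum_i \sum_(j | j != i) a i ^+ 2 * c i j.
  rewrite (exchange_big_dep predT)//=; apply: eq_bigr => j _.
  by apply: eq_big => [i|i _]; [rewrite eq_sym|rewrite csym].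
have : \sum_i \sum_(j | j != i) `|a i| * `|a j| * c i j <=
  \sum_i \sum_(j | j != i) (2^-1 * (a i ^+ 2 * c i j) + 2^-1 * (a j ^+ 2 * c i j)).
  apply: ler_sum => i _; apply: ler_sum => j _.
  rewrite -(real_normK (num_real (a i))) -(real_normK (num_real (a j))).
  have := c0 i j; have := sqr_ge0 (`|a i| - `|a j|); nra.
move=> /le_trans; apply.
have -> : \sum_i \sum_(j | j != i)
    (2^-1 * (a i ^+ 2 * c i j) + 2^-1 * (a j ^+ 2 * c i j)) =
    2^-1 * (\sum_i \sum_(j | j != i) a i ^+ 2 * c i j) +
    2^-1 * (\sum_i \sum_(j | j != i) a j ^+ 2 * c i j).
  rewrite !mulr_sumr -big_split /=; apply: eq_bigr => i _.
  by rewrite !mulr_sumr -big_split.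
by rewrite half'; move: half; lra.
Qed.

(** * Quasiperiodic trigonometric sums *)

Lemma is_derive_bigsum (R : realType) (V : normedModType R) (I : Type)
    (r : seq I) (P : pred I) (F dF : I -> V -> R) (x v : V) :
  (forall i, is_derive x v (F i) (dF i x)) ->
  is_derive x v (fun s => \sum_(i <- r | P i) F i s)
                (\sum_(i <- r | P i) dF i x).
Proof.
move=> dFi; elim: r => [|i r IH].
  rewrite big_nil (_ : (fun s => _) = cst 0); first exact: is_derive_cst.
  by apply/funext => s; rewrite big_nil.
rewrite big_cons; case: ifPn => Pi.
  rewrite (_ : (fun s => _) = F i + (fun s => \sum_(i <- r | P i) F i s)).
    exact: is_deriveD.
  by apply/funext => s; rewrite big_cons Pi.
rewrite (_ : (fun s => _) = (fun s => \sum_(i <- r | P i) F i s)) //.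
by apply/funext => s; rewrite big_cons (negbTE Pi).
Qed.

Lemma MVT_is_derive (R : realType) (f df : R -> R) (a b : R) : a < b ->
  (forall x : R, is_derive x 1 f (df x)) ->
  exists2 c, a < c < b & f b - f a = df c * (b - a).
Proof.
move=> ab dfE; have [c] : exists2 c, c \in `]a, b[ & f b - f a = df c * (b - a).
  apply: MVT => //; apply: derivable_within_continuous => x _.
  by case: (dfE x).
by rewrite in_itv /= => cab; exists c.
Qed.

(** The second difference is the integral of [f2] against the triangular weight on [[0, 2T]]. Three
    uses of the mean value theorem give its sign without any integral: the slopes over [[0, T]] and
    [[T, 2T]] are values of [f1], which does not decrease between them. *)
Lemma second_difference_ge0 (R : realType) (f f1 f2 : R -> R) (T : R) :
  0 < T -> (forall x : R, is_derive x 1 f (f1 x)) ->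
  (forall x : R, is_derive x 1 f1 (f2 x)) ->
  (forall x, 0 <= x <= 2 * T -> 0 <= f2 x) ->
  0 <= f 0 + f (2 * T) - 2 * f T.
Proof.
move=> T0 df df1 f20.
have [c cI ce] := MVT_is_derive T0 df.
have T2 : T < 2 * T by lra.
have [e eI ee] := MVT_is_derive T2 df.
have ce' : c < e by move: cI eI => /andP[_ +] /andP[+ _]; lra.
have [x xI xe] := MVT_is_derive ce' df1.
have x0 : 0 <= f2 x.
  by apply: f20; move: cI eI xI => /andP[? ?] /andP[? ?] /andP[? ?]; apply/andP; split; lra.
have : f1 c <= f1 e by rewrite -subr_ge0 xe mulr_ge0// subr_ge0 ltW.
by move: ce ee; rewrite !subr0 => ce ee; nra.
Qed.

Section Quasiperiodic.
Variables (R : realType) (I : finType) (v z : I -> R).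

Definition phase (i j : I) (s : R) : R := s * (v i - v j) - (z i - z j).

(* The squared modulus of [\sum_i a i e^(i (s v i - z i))]. *)
Definition energy (a : I -> R) (s : R) : R :=
  \sum_i \sum_j a i * a j * cos (phase i j s).

(** Termwise antiderivative of [energy]: the diagonal terms grow with [s], while each off-diagonal
    term stays bounded and gains a denominator [v i - v j]. *)
Definition energy_int (a : I -> R) (s : R) : R :=
  \sum_i (a i ^+ 2 * s +
    \sum_(j | j != i) a i * a j * (sin (phase i j s) / (v i - v j))).

(** The second antiderivative: its off-diagonal denominators are squares, whose inverses are
    summable uniformly over separated frequencies. *)
Definition energy_int2 (a : I -> R) (s : R) : R :=
  \sum_i (a i ^+ 2 * (s ^+ 2 / 2) -
    \sum_(j | j != i) a i * a j * (cos (phase i j s) / (v i - v j) ^+ 2)).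

Hypothesis v_inj : forall i j, j != i -> v i - v j != 0.

Lemma is_derive_phase i j (s : R) : is_derive s 1 (phase i j) (v i - v j).
Proof.
have -> : phase i j = (v i - v j) *: (@id R) + cst (- (z i - z j)).
  by apply/funext => x; rewrite /phase /= !fctE mulrC.
by apply: is_derive_eq; rewrite subr0 /GRing.scale /= mulr1.
Qed.

Lemma is_derive_energy_int (a : I -> R) (s : R) :
  is_derive s 1 (energy_int a) (energy a s).
Proof.
have -> : energy a s = \sum_i (a i ^+ 2 +
    \sum_(j | j != i) a i * a j * cos (phase i j s)).
  apply: eq_bigr => i _; rewrite (bigD1 i)//=; congr (_ + _).
  by rewrite /phase !subrr mulr0 subr0 cos0 mulr1 expr2.
rewrite /energy_int.
apply: (@is_derive_bigsum _ _ _ _ _ _ (fun i s => a i ^+ 2 +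
    \sum_(j | j != i) a i * a j * cos (phase i j s))) => i.
apply: (@is_deriveD _ _ _ (fun s => a i ^+ 2 * s)
  (fun s => \sum_(j | j != i) a i * a j * (sin (phase i j s) / (v i - v j)))).
  rewrite (_ : (fun s => _) = a i ^+ 2 *: (@id R)); last exact/funext.
  by apply: is_derive_eq; rewrite /GRing.scale /= mulr1.
(* [is_derive_bigsum] asks for a derivative at every index, so the summand is set to 0 at [j = i],
   where [v i - v j] vanishes. *)
rewrite [X in is_derive _ _ X](_ : _ = fun s => \sum_(j | j != i)
   (if j != i then a i * a j * (sin (phase i j s) / (v i - v j)) else 0)); last first.
  by apply/funext => x; apply: eq_bigr => j ->.
rewrite [X in is_derive _ _ _ X](_ : _ = \sum_(j | j != i)
   (if j != i then a i * a j * cos (phase i j s) else 0)); last first.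
  by apply: eq_bigr => j ->.
apply: (@is_derive_bigsum _ _ _ _ _ _ (fun j s =>
  if j != i then a i * a j * cos (phase i j s) else 0)) => j.
case: ifPn => ji; last exact: is_derive_cst.
rewrite (_ : (fun s => _) = (a i * a j / (v i - v j)) *: (sin \o phase i j)); last first.
  by apply/funext => x; rewrite /= !fctE /= [RHS]mulrAC mulrA.
have dph := is_derive_phase i j s.
by apply: is_derive_eq; rewrite /GRing.scale /=; field; exact: v_inj.
Qed.

Lemma is_derive_energy_int2 (a : I -> R) (s : R) :
  is_derive s 1 (energy_int2 a) (energy_int a s).
Proof.
rewrite /energy_int2.
apply: (@is_derive_bigsum _ _ _ _ _ _ (fun i s => a i ^+ 2 * s +
    \sum_(j | j != i) a i * a j * (sin (phase i j s) / (v i - v j)))) => i.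
rewrite -[X in is_derive _ _ _ (_ + X)]opprK.
rewrite (_ : (fun s0 => _) = (fun s => a i ^+ 2 * (s ^+ 2 / 2)) - (fun s =>
    \sum_(j | j != i) a i * a j * (cos (phase i j s) / (v i - v j) ^+ 2)));
  last exact/funext.
apply: is_deriveB.
  rewrite (_ : (fun s => _) = (a i ^+ 2 / 2) *: ((@id R) ^+ 2)); last first.
    by apply/funext => x; rewrite !fctE /GRing.scale /= mulrA mulrAC.
  by apply: is_derive_eq; rewrite /GRing.scale /=; field.
rewrite -sumrN.
rewrite [X in is_derive _ _ X](_ : _ = fun s => \sum_(j | j != i)
   (if j != i then a i * a j * (cos (phase i j s) / (v i - v j) ^+ 2) else 0)); last first.
  by apply/funext => x; apply: eq_bigr => j ->.
rewrite [X in is_derive _ _ _ X](_ : _ = \sum_(j | j != i)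
   (if j != i then - (a i * a j * (sin (phase i j s) / (v i - v j))) else 0)); last first.
  by apply: eq_bigr => j ->.
apply: (@is_derive_bigsum _ _ _ _ _ _ (fun j s =>
  if j != i then - (a i * a j * (sin (phase i j s) / (v i - v j)))
  else 0)) => j.
case: ifPn => ji; last exact: is_derive_cst.
rewrite (_ : (fun s => _) = (a i * a j / (v i - v j) ^+ 2) *: (cos \o phase i j)); last first.
  by apply/funext => x; rewrite /= !fctE /= [RHS]mulrAC mulrA.
have dph := is_derive_phase i j s.
by apply: is_derive_eq; rewrite /GRing.scale /=; field; exact: v_inj.
Qed.
End Quasiperiodic.

(** The diagonal terms [a_i^2 s^2 / 2] have second difference exactly [a_i^2 T^2]. A second
    difference of cosines is at most 4 in absolute value, and Schur's test with the row sums
    [4 / d ^+ 2] yields the constant 16. *)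
Lemma energy_int2_second_difference (R : realType) (I : finType)
    (v z a : I -> R) (d T : R) : 0 < d ->
  (forall i j, i != j -> d <= `|v i - v j|) ->
  `|energy_int2 v z a 0 + energy_int2 v z a (2 * T) - 2 * energy_int2 v z a T
    - T ^+ 2 * \sum_i a i ^+ 2| <= 16 / d ^+ 2 * \sum_i a i ^+ 2.
Proof.
move=> d0 vsep.
have v_inj i j : j != i -> v i - v j != 0.
  by move=> ji; rewrite -normr_gt0 (lt_le_trans d0)// vsep// eq_sym.
pose c i j := ((v i - v j) ^+ 2)^-1.
have c0 i j : 0 <= c i j by rewrite invr_ge0 sqr_ge0.
have -> : energy_int2 v z a 0 + energy_int2 v z a (2 * T)
    - 2 * energy_int2 v z a T - T ^+ 2 * \sum_i a i ^+ 2 =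
  - \sum_i \sum_(j | j != i) a i * a j * c i j *
    (cos (phase v z i j 0) + cos (phase v z i j (2 * T)) - 2 * cos (phase v z i j T)).
  rewrite /energy_int2 -big_split /= !mulr_sumr -!sumrB -sumrN.
  apply: eq_bigr => i _.
  have -> : \sum_(j | j != i) a i * a j * c i j *
      (cos (phase v z i j 0) + cos (phase v z i j (2 * T)) - 2 * cos (phase v z i j T)) =
      \sum_(j | j != i) a i * a j * (cos (phase v z i j 0) / (v i - v j) ^+ 2) +
      \sum_(j | j != i) a i * a j * (cos (phase v z i j (2 * T)) / (v i - v j) ^+ 2) -
      2 * \sum_(j | j != i) a i * a j * (cos (phase v z i j T) / (v i - v j) ^+ 2).
    rewrite mulr_sumr -big_split -sumrB /=.
    by apply: eq_bigr => j _; rewrite /c; ring.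
  by field.
rewrite normrN.
have -> : 16 / d ^+ 2 * \sum_i a i ^+ 2 = 4 * (4 / d ^+ 2 * \sum_i a i ^+ 2).
  by rewrite [4 * (_ * _)]mulrA [4 * (4 / _)]mulrA; congr (_ / _ * _); ring.
have h : \sum_i \sum_(j | j != i) `|a i| * `|a j| * c i j <=
         4 / d ^+ 2 * \sum_i a i ^+ 2.
  apply: schur_test => // i *; first by rewrite /c -sqrrN opprB.
  exact: sum_inv_sq_sep.
apply: le_trans (ler_wpM2l _ h) => //.
apply: (le_trans (ler_norm_sum _ _ _)); rewrite mulr_sumr; apply: ler_sum => i _.
apply: (le_trans (ler_norm_sum _ _ _)); rewrite mulr_sumr; apply: ler_sum => j _.
rewrite !normrM (ger0_norm (c0 i j)) mulrC ler_wpM2r ?mulr_ge0//.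
have := cos_le1 (phase v z i j 0); have := cos_geN1 (phase v z i j 0).
have := cos_le1 (phase v z i j T); have := cos_geN1 (phase v z i j T).
have := cos_le1 (phase v z i j (2 * T)); have := cos_geN1 (phase v z i j (2 * T)).
by move=> *; rewrite ler_norml; apply/andP; split; lra.
Qed.

(* If the conclusion failed, [\sum_k energy (b k) - eta * energy a] would be
   the nonnegative second derivative of a function whose second difference is
   negative: by the separation of the frequencies, the diagonal terms dominate
   that second difference as soon as [T >= 6 / d]. *)
Lemma energy_lt (R : realType) (I K : finType) (v z a : I -> R)
    (b : K -> I -> R) (d eta : R) : 0 < d -> 0 <= eta ->
  (forall i j, i != j -> d <= `|v i - v j|) ->
  3 * \sum_k \sum_i b k i ^+ 2 < eta * \sum_i a i ^+ 2 ->
  exists2 s, 0 <= s <= 12 / d &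
    \sum_k energy v z (b k) s < eta * energy v z a s.
Proof.
move=> d0 eta0 vsep; apply: contraPP => /forall2NP none; apply/negP; rewrite -leNgt.
have v_inj i j : j != i -> v i - v j != 0.
  by move=> ji; rewrite -normr_gt0 (lt_le_trans d0)// vsep// eq_sym.
(* With this [T] the error is 4/9 of the main term, so each second difference lies between 5/9 and
   13/9 of it; the ratio 13/5 is below the 3 of the hypothesis. *)
pose T := 6 / d; have T0 : 0 < T by rewrite divr_gt0.
have T2 : 16 / d ^+ 2 = 4 / 9 * T ^+ 2 by rewrite /T; field; rewrite gt_eqF.
pose f := fun s => \sum_k energy_int2 v z (b k) s - eta * energy_int2 v z a s.
pose f1 := fun s => \sum_k energy_int v z (b k) s - eta * energy_int v z a s.
pose f2 := fun s => \sum_k energy v z (b k) s - eta * energy v z a s.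
have df (x : R) : is_derive x 1 f (f1 x).
  apply: (@is_deriveB _ _ _ (fun s => \sum_k energy_int2 v z (b k) s)
                            (eta *: energy_int2 v z a)).
    apply: (@is_derive_bigsum _ _ _ _ _ _ (fun k => energy_int v z (b k))) => k.
    exact: is_derive_energy_int2.
  apply: is_deriveZ; exact: is_derive_energy_int2.
have df1 (x : R) : is_derive x 1 f1 (f2 x).
  apply: (@is_deriveB _ _ _ (fun s => \sum_k energy_int v z (b k) s)
                            (eta *: energy_int v z a)).
    apply: (@is_derive_bigsum _ _ _ _ _ _ (fun k => energy v z (b k))) => k.
    exact: is_derive_energy_int.
  apply: is_deriveZ; exact: is_derive_energy_int.
have f20 x : 0 <= x <= 2 * T -> 0 <= f2 x.
  move=> xI; have [|/negP] := none x; last by rewrite -leNgt -subr_ge0.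
  by case; move: xI; rewrite /T (_ : 12 / d = 2 * (6 / d))//; field; rewrite gt_eqF.
have := second_difference_ge0 T0 df df1 f20.
pose D g := energy_int2 v z g 0 + energy_int2 v z g (2 * T) - 2 * energy_int2 v z g T.
have -> : f 0 + f (2 * T) - 2 * f T = \sum_k D (b k) - eta * D a.
  by rewrite /f /D sumrB big_split -mulr_sumr /=; ring.
have DE g : `|D g - T ^+ 2 * \sum_i g i ^+ 2| <= 4 / 9 * T ^+ 2 * \sum_i g i ^+ 2.
  by rewrite -T2; exact: energy_int2_second_difference.
have h1 : \sum_k D (b k) <= 13 / 9 * T ^+ 2 * \sum_k \sum_i b k i ^+ 2.
  rewrite mulr_sumr; apply: ler_sum => k _.
  have := DE (b k); rewrite ler_norml => /andP[_]; lra.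
have h2 : 5 / 9 * T ^+ 2 * \sum_i a i ^+ 2 <= D a.
  have := DE a; rewrite ler_norml => /andP[+ _]; lra.
have {}h2 := ler_wpM2l eta0 h2.
move=> h3.
have T20 : 0 < T ^+ 2 by rewrite exprn_gt0.
have B0 : 0 <= \sum_k \sum_i b k i ^+ 2.
  by apply: sumr_ge0 => k _; apply: sumr_ge0 => i _; exact: sqr_ge0.
rewrite -(ler_pM2l T20).
nra.
Qed.

Lemma energy_sqr (R : realType) (I : finType) (v z a : I -> R) (s : R) :
  energy v z a s = (\sum_i a i * cos (s * v i - z i)) ^+ 2 +
                   (\sum_i a i * sin (s * v i - z i)) ^+ 2.
Proof.
rewrite !expr2 !big_distrlr /= -big_split; apply: eq_bigr => i _ /=.
rewrite -big_split; apply: eq_bigr => j _ /=.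
have -> : phase v z i j s = (s * v i - z i) - (s * v j - z j).
  by rewrite /phase; ring.
by rewrite cosB; ring.
Qed.

(* Multiplication of a trigonometric sum by [e^(i theta) - 1] amounts to
   differencing its coefficients. *)
Lemma energy_difference (R : realType) (I : finType) (v z a : I -> R)
    (f g : I -> I) (s theta : R) : cancel f g -> cancel g f ->
  (forall i, a i != 0 -> s * v (f i) - z (f i) = s * v i - z i + theta) ->
  energy v z (fun i => a (g i) - a i) s =
  (2 - 2 * cos theta) * energy v z a s.
Proof.
move=> fK gK shift; rewrite !energy_sqr.
have shiftE (h : R -> R) :
    \sum_i (a (g i) - a i) * h (s * v i - z i) =
    \sum_i a i * h (s * v i - z i + theta) - \sum_i a i * h (s * v i - z i).
  rewrite -sumrB.
  under eq_bigr do rewrite mulrBl.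
  rewrite !sumrB; congr (_ - _).
  (* Where [a i] vanishes nothing is asked of the phases; this is what lets [f] be a cyclic shift
     that wraps around. *)
  rewrite (reindex_inj (can_inj fK)) /=; apply: eq_bigr => i _.
  rewrite fK; have [->|a0] := eqVneq (a i) 0; first by rewrite !mul0r.
  by rewrite shift.
rewrite !shiftE.
have -> : \sum_i a i * cos (s * v i - z i + theta) =
    (\sum_i a i * cos (s * v i - z i)) * cos theta -
    (\sum_i a i * sin (s * v i - z i)) * sin theta.
  by rewrite !mulr_suml -sumrB; apply: eq_bigr => i _; rewrite cosD; ring.
have -> : \sum_i a i * sin (s * v i - z i + theta) =
    (\sum_i a i * sin (s * v i - z i)) * cos theta +
    (\sum_i a i * cos (s * v i - z i)) * sin theta.
  by rewrite !mulr_suml -big_split; apply: eq_bigr => i _; rewrite sinD /=; ring.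
set C := \sum_i _; set S := \sum_i _.
have := cos2Dsin2 theta; move: (cos theta) (sin theta) => c t ct.
have -> : 2 - 2 * c = (1 - c) ^+ 2 + t ^+ 2 by rewrite -ct; nra.
by ring.
Qed.

(** * Tent functions on a box *)

(** A trapezoid: it rises with slope [1 / q] on [[0, q]], equals 1 on [[q, 2q]] and falls back to 0
    at [3q]. *)
Definition tent (R : realType) (q j : nat) : R :=
  (minn q (minn j (3 * q - j)))%:R / q%:R.

Lemma tent_ge0 (R : realType) q j : 0 <= tent R q j.
Proof. by rewrite divr_ge0. Qed.

Lemma tent_le1 (R : realType) q j : tent R q j <= 1.
Proof.
case: q => [|q]; first by rewrite /tent invr0 mulr0.
by rewrite /tent ler_pdivrMr ?ltr0n// mul1r ler_nat geq_minl.
Qed.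

Lemma tent_lipschitz (R : realType) q i j : (i <= j.+1)%N -> (j <= i.+1)%N ->
  `|tent R q i - tent R q j| <= q%:R^-1.
Proof.
move=> ij ji; rewrite /tent -mulrBl normrM normfV normr_nat.
rewrite ler_piMl ?invr_ge0//.
set x := minn _ _; set y := minn _ _.
have : (x <= y + 1)%N by rewrite /x /y; lia.
have : (y <= x + 1)%N by rewrite /x /y; lia.
rewrite -!(ler_nat R) !natrD => *.
by rewrite ler_norml; apply/andP; split; lra.
Qed.

(** The plateau from [q] to [2q] alone has [q + 1] points. *)
Lemma sum_tent_ge (R : realType) q : (0 < q)%N ->
  q.+1%:R <= \sum_(j < (3 * q).+1) tent R q j ^+ 2.
Proof.
move=> q0; rewrite -(big_mkord xpredT (fun j => tent R q j ^+ 2)).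
rewrite (big_cat_nat (n := q))/=; [|lia|lia].
rewrite (big_cat_nat (m := q) (n := (2 * q).+1))/=; [|lia|lia].
apply: (@le_trans _ _ (\sum_(q <= j < (2 * q).+1) tent R q j ^+ 2)).
  rewrite (eq_big_nat _ _ (F2 := fun=> 1)) => [|j jI].
    by rewrite sumr_const_nat ler_nat; lia.
  rewrite /tent (_ : minn _ _ = q) ?divff ?expr1n ?pnatr_eq0 ?gtn_eqF//.
  by move: jI; lia.
have ge0 m n : 0 <= \sum_(m <= j < n) tent R q j ^+ 2.
  by apply: sumr_ge0 => j _; exact: sqr_ge0.
by rewrite addrCA lerDl addr_ge0.
Qed.

Section Box.
Variables (R : realType) (n q : nat).
Hypothesis q_gt0 : (0 < q)%N.

Let box := {ffun 'I_n -> 'I_(3 * q).+1}.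

Definition tent_prod (m : box) : R := \prod_i tent R q (m i).

(** The shift is cyclic, hence a bijection of the box; the wrap-around joins [3q] to 0, and [tent]
    vanishes at both. *)
Definition box_next (k : 'I_n) (m : box) : box :=
  [ffun i => if i == k then ordS (m i) else m i].

Definition box_prev (k : 'I_n) (m : box) : box :=
  [ffun i => if i == k then ord_pred (m i) else m i].

(** The coefficients of [P] multiplied by [e^(2 i pi x_k) - 1], when [P] has the coefficients
    [tent_prod]. *)
Definition tent_diff (k : 'I_n) (m : box) : R :=
  tent_prod (box_prev k m) - tent_prod m.

Lemma box_nextK k : cancel (box_next k) (box_prev k).
Proof. by move=> m; apply/ffunP => i; rewrite !ffunE; case: eqP => // _; rewrite ordSK. Qed.

Lemma box_prevK k : cancel (box_prev k) (box_next k).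
Proof. by move=> m; apply/ffunP => i; rewrite !ffunE; case: eqP => // _; rewrite ord_predK. Qed.

Lemma sum_tent_prod_ge : q.+1%:R ^+ n <= \sum_m tent_prod m ^+ 2.
Proof.
have -> : \sum_m tent_prod m ^+ 2 =
    \prod_(i < n) \sum_(j < (3 * q).+1) tent R q j ^+ 2.
  by rewrite bigA_distr_bigA /=; apply: eq_bigr => m _; rewrite prodrXl.
rewrite prodr_const card_ord.
by apply: lerXn2r; rewrite ?nnegrE ?sum_tent_ge//; apply: sumr_ge0 => *; exact: sqr_ge0.
Qed.

Lemma tent_ord_pred (j : 'I_(3 * q).+1) :
  `|tent R q (ord_pred j) - tent R q j| <= q%:R^-1.
Proof.
case: j => -[|j] jlt.
  (* The cyclic predecessor of 0 is [3q], so both tents are 0. *)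
  rewrite /= modn_small; last by lia.
  by rewrite /tent /= subnn !min0n minn0 mul0r subrr normr0 invr_ge0.
rewrite (_ : nat_of_ord (ord_pred _) = j); last first.
  by rewrite /= modnDr modn_small//; lia.
by apply: tent_lipschitz => /=; lia.
Qed.

(** Only the factor of index [k] changes, by at most [1 / q]; the others lie in [[0, 1]]. *)
Lemma tent_diff_le k m : `|tent_diff k m| <= q%:R^-1.
Proof.
rewrite /tent_diff /tent_prod (bigD1 k)//= [X in _ - X](bigD1 k)//= ffunE eqxx.
rewrite [X in _ * X - _](_ : _ = \prod_(i < n | i != k) tent R q (m i)); last first.
  by apply: eq_bigr => i /negbTE ik; rewrite ffunE ik.
rewrite -mulrBl normrM; apply: le_trans (tent_ord_pred (m k)).
rewrite ler_piMr// ger0_norm; last by apply: prodr_ge0 => *; exact: tent_ge0.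
by apply: prodr_ile1 => *; rewrite tent_ge0 tent_le1.
Qed.

(** The box has [(3q + 1)^n] points, bounded by [(3 (q + 1))^n] so that the factor [(q + 1)^n]
    matches the lower bound [sum_tent_prod_ge]. *)
Lemma sum_tent_diff_le k :
  \sum_m tent_diff k m ^+ 2 <= 3 ^+ n * q.+1%:R ^+ n / q%:R ^+ 2.
Proof.
have -> : 3 ^+ n * q.+1%:R ^+ n / q%:R ^+ 2 =
    \sum_(m : {ffun 'I_n -> 'I_(3 * q.+1)}) (q%:R ^+ 2)^-1 :> R.
  rewrite sumr_const card_ffun !card_ord -[RHS]mulr_natl; congr (_ * _).
  by rewrite natrX natrM exprMn.
apply: (@le_trans _ _ (\sum_(m : box) (q%:R ^+ 2)^-1)).
  apply: ler_sum => m _; rewrite -exprVn -real_normK ?num_real//.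
  by apply: lerXn2r; rewrite ?nnegrE ?invr_ge0// tent_diff_le.
rewrite !sumr_const !card_ffun !card_ord.
by apply: ler_wpMn2l; rewrite ?invr_ge0 ?sqr_ge0//; case: (n) => [//|n'];
  rewrite leq_exp2r; lia.
Qed.
End Box.

(** * Density of Diophantine linear flows *)

(** Jordan's inequality. If the sine were below its chord at [x], the mean value theorem on both
    sides of [x] would give [c < e] with [cos c < 2 / pi < cos e], although the cosine decreases. *)
Lemma sin_ge_chord (R : realType) (x : R) : 0 <= x <= pi / 2 ->
  2 / pi * x <= sin x.
Proof.
move=> /andP[]; rewrite le_eqVlt => /predU1P[<- _|x0]; first by rewrite sin0 mulr0.
have pi0 := pi_gt0 R.
rewrite le_eqVlt => /predU1P[->|xpi].
  by rewrite sin_pihalf; move: (pi) pi0 => p p0; rewrite le_eqVlt (_ : _ * _ = 1) ?eqxx//;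
    field; rewrite gt_eqF.
rewrite leNgt; apply/negP => hx.
pose h := sin - (2 / pi) *: (@id R).
have dh (t : R) : is_derive t 1 h (cos t - 2 / pi).
  by rewrite /h; apply: is_derive_eq; rewrite /GRing.scale /= mulr1.
have hE t : h t = sin t - 2 / pi * t by [].
have [c /andP[c0 cx] ec] := MVT_is_derive x0 dh.
have [e /andP[xe epi] ee] := MVT_is_derive xpi dh.
have h0 : h 0 = 0 by rewrite hE sin0 mulr0 subr0.
have hpi : h (pi / 2) = 0.
  by rewrite hE sin_pihalf; move: (pi) pi0 => p p0; field; rewrite gt_eqF.
have hx0 : h x < 0 by rewrite hE subr_lt0.
have c1 : cos c - 2 / pi < 0.
  by move: ec; rewrite h0 !subr0 => ec; rewrite -(pmulr_llt0 _ x0) -ec.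
have e1 : 0 < cos e - 2 / pi.
  have xp : 0 < pi / 2 - x by rewrite subr_gt0.
  by rewrite -(pmulr_lgt0 _ xp) -ee hpi sub0r oppr_gt0.
have : cos c < cos e by lra.
by rewrite ltr_cos ?in_itv /=; first lra; apply/andP; split; lra.
Qed.

(** The right-hand side is [4 sin^2 (pi r)], and Jordan's inequality bounds the sine below by
    [2 |r|]. *)
Lemma cos_2pi_le (R : realType) (r : R) : `|r| <= 2^-1 ->
  16 * r ^+ 2 <= 2 - 2 * cos (2 * pi * r).
Proof.
move=> r2; have pi0 := pi_gt0 R.
have -> : cos (2 * pi * r) = cos ((pi * `|r|) *+ 2).
  rewrite mulr2n -mulr2n -mulr_natl mulrA; have [r0|r0] := leP 0 r.
    by rewrite ger0_norm.
  by rewrite ltr0_norm// mulrN cosN.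
rewrite cos_mulr2n cos2sin2.
have s2 : 2 * `|r| <= sin (pi * `|r|).
  rewrite (_ : 2 * `|r| = 2 / pi * (pi * `|r|)); last first.
    by move: (pi) pi0 => p p0; field; rewrite gt_eqF.
  by apply: sin_ge_chord; rewrite mulr_ge0 ?pi_ge0//= ler_pM2l.
have : (2 * `|r|) ^+ 2 <= sin (pi * `|r|) ^+ 2.
  by apply: lerXn2r; rewrite ?nnegrE ?mulr_ge0// (le_trans _ s2)// mulr_ge0.
by rewrite exprMn real_normK ?num_real//; lra.
Qed.

Lemma cos_2piDz (R : realType) (r : R) (k : int) :
  cos (2 * pi * (r + k%:~R)) = cos (2 * pi * r).
Proof.
have per (m : nat) (x : R) : cos (2 * pi * (x + m%:R)) = cos (2 * pi * x).
  elim: m => [|m IH]; first by rewrite addr0.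
  rewrite -IH -(cosD2pi (2 * pi * (x + m%:R))); congr cos.
  by rewrite -natr1 -mulr_natl; ring.
case: k => m; first exact: per.
by rewrite NegzE rmorphN /= -[in RHS](subrK m.+1%:R r) per.
Qed.

Lemma intvecB (R : realType) (n : nat) (k l : 'cV[int]_n) :
  intvec R (k - l) = intvec R k - intvec R l.
Proof. by apply/matrixP => i j; rewrite !mxE rmorphB. Qed.

Lemma dotBr (R : realType) (n : nat) (v w x : 'cV[R]_n) :
  dot v (w - x) = dot v w - dot v x.
Proof. by rewrite /dot -sumrB; apply: eq_bigr => i _; rewrite !mxE mulrBr. Qed.

Section Ergodization.
Variables (R : realType) (n : nat) (rho alpha : R) (w z : 'cV[R]_n) (q : nat).
Hypotheses (n_gt0 : (0 < n)%N) (q_gt0 : (0 < q)%N).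
Hypotheses (rho_ge0 : 0 <= rho) (alpha_gt0 : 0 < alpha).
Hypothesis w_dioph : Diophantine n rho alpha w.

Let box := {ffun 'I_n -> 'I_(3 * q).+1}.

Let kvec (m : box) : 'cV[int]_n := \col_i (m i)%:Z.

(** With these frequencies and the offsets below, [energy] at time [s] is the squared modulus of [P]
    at the point [s w - z]. *)
Let frequency (m : box) : R := 2 * pi * dot w (intvec R (kvec m)).

Let offset (m : box) : R := 2 * pi * dot z (intvec R (kvec m)).

Lemma l1norm_box (m m' : box) :
  l1norm (intvec R (kvec m - kvec m')) <= (3 * n * q)%:R.
Proof.
have -> : (3 * n * q)%N = (\sum_(i < n) (3 * q))%N.
  by rewrite sum_nat_const card_ord; lia.
rewrite /l1norm natr_sum; apply: ler_sum => i _.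
rewrite !mxE -intr_norm -mulrz_nat ler_int.
by have := ltn_ord (m i); have := ltn_ord (m' i); lia.
Qed.

(** Two distinct modes differ by a nonzero integer vector of norm at most [3nq], to which the
    Diophantine condition applies; the factor [2 pi >= 1] is dropped. *)
Lemma frequency_sep (m m' : box) : m != m' ->
  alpha / (3 * n * q)%:R `^ rho <= `|frequency m - frequency m'|.
Proof.
move=> mm'; have k0 : kvec m - kvec m' != 0.
  apply: contra mm' => /eqP/matrixP kk; apply/eqP/ffunP => i; apply/val_inj.
  move: (kk i 0); rewrite !mxE => /eqP; rewrite subr_eq0 => /eqP [].
  by [].
have l0 : 0 < l1norm (intvec R (kvec m - kvec m')).
  have [i ki] : exists i, (kvec m - kvec m') i 0 != 0.
    apply/existsP; apply: contraR k0; rewrite negb_exists => /forallP k0.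
    apply/eqP/matrixP => i j; rewrite (ord1 j) [RHS]mxE; apply/eqP.
    by have := k0 i; rewrite negbK.
  rewrite /l1norm (bigD1 i)//= ltr_pwDl ?sumr_ge0// normr_gt0 mxE intr_eq0.
  exact: ki.
rewrite /frequency -mulrBr -dotBr -intvecB normrM.
have pi2 : 1 <= `|2 * pi : R|.
  by move: (pi_ge2 R) => h; rewrite ger0_norm; lra.
apply: le_trans (ler_peMl (normr_ge0 _) pi2).
apply: le_trans (w_dioph.2 _ k0); rewrite ler_pM2l// lef_pV2 ?posrE ?powR_gt0//.
  by apply: ge0_ler_powR; rewrite ?nnegrE ?(ltW l0)// l1norm_box.
by rewrite ltr0n; lia.
Qed.

Lemma dot_box_next (x : 'cV[R]_n) (k : 'I_n) (m : box) :
  (m k < 3 * q)%N ->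
  dot x (intvec R (kvec (box_next k m))) = dot x (intvec R (kvec m)) + x k 0.
Proof.
move=> mk; rewrite /dot (bigD1 k)//= [in RHS](bigD1 k)//= addrAC; congr (_ + _).
  rewrite !mxE ffunE eqxx /= modn_small//.
  by rewrite -[(m k).+1]addn1 PoszD rmorphD /= mulrDr mulr1.
by apply: eq_bigr => i /negbTE ik; rewrite !mxE ffunE ik.
Qed.

Lemma orbit_cos : exists2 s : R,
  0 <= s <= 12 / (alpha / (3 * n * q)%:R `^ rho) &
  forall i, 2 - 2 * cos (2 * pi * (s * w i 0 - z i 0)) <
            (4 * n * 3 ^ n)%:R / q%:R ^+ 2.
Proof.
set d := alpha / _; set eta := _ / q%:R ^+ 2.
have d0 : 0 < d by rewrite divr_gt0// powR_gt0// ltr0n; lia.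
have q0 : 0 < q%:R ^+ 2 :> R by rewrite exprn_gt0// ltr0n.
have eta0 : 0 <= eta by rewrite divr_ge0// ltW.
(* The [n] differenced families account for [3 * n * 3 ^ n]; the 4 in [eta] leaves room for a strict
   inequality. *)
have small : 3 * \sum_k \sum_m (@tent_diff R n q k m) ^+ 2 <
             eta * \sum_m (@tent_prod R n q m) ^+ 2.
  apply: (@lt_le_trans _ _ (eta * q.+1%:R ^+ n)); last first.
    by rewrite ler_wpM2l// sum_tent_prod_ge.
  apply: (@le_lt_trans _ _ (3 * \sum_(k < n) (3 ^+ n * q.+1%:R ^+ n / q%:R ^+ 2))).
    by rewrite ler_pM2l//; apply: ler_sum => k _; exact: sum_tent_diff_le.
  rewrite sumr_const card_ord /eta !natrM natrX -[_ *+ n]mulr_natl -subr_gt0.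
  rewrite (_ : _ - _ = n%:R * (3 ^+ n * q.+1%:R ^+ n / q%:R ^+ 2)).
    by rewrite mulr_gt0 ?ltr0n// divr_gt0// mulr_gt0// exprn_gt0// ltr0n.
  by field; rewrite pnatr_eq0 -lt0n.
have [s sI sE] := energy_lt offset d0 eta0 frequency_sep small.
exists s => // i; set E := energy _ _ _ _ in sE.
have EE k : energy frequency offset (@tent_diff R n q k) s =
    (2 - 2 * cos (2 * pi * (s * w k 0 - z k 0))) * E.
  apply: (energy_difference (box_nextK k) (box_prevK k)) => m am0.
  (* A nonzero coefficient excludes the face [m k = 3q], so the shift does not wrap around. *)
  have mk : (m k < 3 * q)%N.
    rewrite ltn_neqAle -ltnS ltn_ord andbT; apply: contra am0 => /eqP mk.
    by rewrite /tent_prod (bigD1 k)//= mk /tent subnn !minn0 !mul0r.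
  by rewrite /frequency /offset !dot_box_next//; ring.
move: sE; under eq_bigr do rewrite EE; rewrite -mulr_suml => sE.
(* [E] is a sum of two squares, and the strict inequality excludes 0; dividing by [E] then bounds a
   sum of nonnegative terms, hence each of them. *)
have E0 : 0 < E.
  rewrite lt_neqAle /E energy_sqr addr_ge0 ?sqr_ge0// andbT -energy_sqr -/E.
  by apply/eqP => E0; move: sE; rewrite -E0 !mulr0 ltxx.
apply: le_lt_trans (_ : \sum_i (2 - 2 * cos (2 * pi * (s * w i 0 - z i 0))) < _).
  rewrite (bigD1 i)//= lerDl; apply: sumr_ge0 => k _.
  by have := cos_le1 (2 * pi * (s * w k 0 - z k 0)); lra.
by rewrite -(ltr_pM2r E0).
Qed.

Lemma orbit_near : exists2 s : R,
  0 <= s <= 12 / (alpha / (3 * n * q)%:R `^ rho) &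
  exists k : 'cV[int]_n, forall i,
    `|s * w i 0 - z i 0 - (k i 0)%:~R| <= (n * 3 ^ n)%:R / q%:R.
Proof.
have [s sI sE] := orbit_cos; exists s => //.
(* Rounding to the nearest integer leaves a remainder in [[-1/2, 1/2]], where [cos_2pi_le]
   applies. *)
exists (\col_i Num.floor (s * w i 0 - z i 0 + 2^-1)) => i.
rewrite mxE; set y := s * _ - _; set k := Num.floor _.
have yk : `|y - k%:~R| <= 2^-1.
  have := floor_le_tmp (y + 2^-1); have := floorD1_gt (y + 2^-1).
  by rewrite intrD ler_norml -/k => *; apply/andP; split; lra.
have {sE} := sE i; rewrite -/y -[y](subrK k%:~R) cos_2piDz.
have q0 : 0 < q%:R :> R by rewrite ltr0n.
rewrite addrK => /(le_lt_trans (cos_2pi_le yk)) yE.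
rewrite -(ler_pXn2r (ltn0Sn 1)) ?nnegrE ?divr_ge0// real_normK ?num_real//.
(* Squaring the integer [n * 3 ^ n >= 1] does not decrease it, which avoids a square root in the
   final bound. *)
have : (4 * n * 3 ^ n)%:R / q%:R ^+ 2 <= 4 * ((n * 3 ^ n)%:R / q%:R) ^+ 2 :> R.
  rewrite expr_div_n mulrA ler_pM2r ?invr_gt0 ?exprn_gt0//.
  rewrite -natrX -natrM ler_nat -mulnA leq_pmul2l// -[X in (X <= _)%N]muln1.
  by rewrite expnS expn1 leq_pmul2l ?muln_gt0 ?n_gt0 ?expn_gt0.
by move: yE (sqr_ge0 (y - k%:~R)); lra.
Qed.
End Ergodization.

(** Precision [1 / q] takes a time [D q^rho]. Taking [q] of order [t^beta] keeps this time below
    [t], because [beta * rho <= 1] and [t >= 1]. *)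
Lemma flow_dense (R : realType) (n : nat) (rho alpha : R) : (0 < n)%N ->
  n%:R - 1 < rho -> 0 < alpha ->
  exists2 C : R, 0 < C & forall w : 'cV[R]_n, Diophantine n rho alpha w ->
    forall (x : 'cV[R]_n) (t : R), 1 <= t ->
    exists2 s, t <= s <= 2 * t & exists k : 'cV[int]_n, forall i,
      `|x i 0 - s * w i 0 - (k i 0)%:~R| <= C * t `^ (- (2 / (2 * rho + n%:R))).
Proof.
move=> n0 rhon a0.
have n1 : 1 <= n%:R :> R by rewrite ler1n.
have rho0 : 0 < rho by lra.
pose beta := 2 / (2 * rho + n%:R).
have beta0 : 0 < beta by rewrite divr_gt0//; lra.
have betarho : beta * rho <= 1.
  by rewrite /beta mulrAC ler_pdivrMr; lra.
(* [D q^rho] is the time bound of [orbit_near]; [A] below is chosen so that [D A^rho = 1]. *)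
pose D : R := 12 * (3 * n)%:R `^ rho / alpha.
have D0 : 0 < D.
  by rewrite divr_gt0// mulr_gt0// powR_gt0// ltr0n muln_gt0 n0.
pose A := D `^ (- rho^-1); have A0 : 0 < A by rewrite powR_gt0.
have DA : D * A `^ rho = 1.
  by rewrite /A -powRrM mulNr mulVf ?gt_eqF// powR_inv1 ?ltW// divff ?gt_eqF.
pose c : R := (n * 3 ^ n)%:R; have c0 : 0 <= c by [].
(* The first summand serves for [q > 0], where [A t^beta < q + 1 <= 2q]. The second serves for
   [q = 0], where [A t^beta < 1] and plain rounding at time [t] is precise enough. *)
exists (2 * c / A + A^-1); first by rewrite ltr_wpDl ?invr_gt0// divr_ge0 ?mulr_ge0// ltW.
move=> w w_dioph x t t1; have t0 : 0 < t by lra.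
have At0 : 0 < A * t `^ beta by rewrite mulr_gt0 ?powR_gt0.
rewrite -/beta powRN.
pose q := Num.truncn (A * t `^ beta).
have /andP[qle ltq] : q%:R <= A * t `^ beta < q.+1%:R.
  by apply: truncn_itv; exact: ltW.
have [q0|q0] := posnP q.
  exists t; first by apply/andP; split; lra.
  exists (\col_i Num.floor (x i 0 - t * w i 0 + 2^-1)) => i.
  rewrite mxE; set y := x i 0 - _; set k := Num.floor _.
  have : `|y - k%:~R| <= 2^-1.
    have := floor_le_tmp (y + 2^-1); have := floorD1_gt (y + 2^-1).
    by rewrite intrD ler_norml -/k => *; apply/andP; split; lra.
  move=> /le_trans; apply; rewrite mulrDl -invfM.
  apply: (@le_trans _ _ (A * t `^ beta)^-1); last first.
    by rewrite lerDr mulr_ge0 ?invr_ge0 ?powR_ge0// divr_ge0 ?mulr_ge0// ltW.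
  by rewrite lef_pV2 ?posrE//; move: ltq; rewrite q0; lra.
(* Aiming at [x - t w] turns a time in [[0, t]] into the time [t + s] in [[t, 2t]]. *)
have [s /andP[s0 sD] [k sk]] :=
  orbit_near (x - t *: w) n0 q0 (ltW rho0) a0 w_dioph.
exists (t + s).
  rewrite lerDl s0 /= mulr_natl mulr2n lerD2l; apply: (le_trans sD).
  rewrite invf_div mulrA natrM powRM// mulrA.
  have -> : t = D * A `^ rho * t by rewrite DA mul1r.
  rewrite [X in X <= _](_ : _ = D * q%:R `^ rho); last by rewrite /D; ring.
  rewrite -mulrA ler_pM2l//.
  apply: (@le_trans _ _ ((A * t `^ beta) `^ rho)).
    by apply: ge0_ler_powR; rewrite ?nnegrE// ltW.
  rewrite powRM ?powR_ge0 ?(ltW A0)// ler_pM2l ?powR_gt0// -powRrM.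
  by rewrite -[leRHS]powRr1 ?(ltW t0)// ler_powR.
exists (- k) => i; rewrite !mxE rmorphN /= opprK.
have := sk i; rewrite !mxE -normrN.
rewrite (_ : - (_ - _ - _) = x i 0 - (t + s) * w i 0 + (k i 0)%:~R); last by ring.
move=> /le_trans; apply; rewrite -/c; clearbody c; rewrite mulrDl.
apply: (@le_trans _ _ (2 * c / A / t `^ beta)); last first.
  by rewrite lerDl mulr_ge0 ?invr_ge0 ?powR_ge0// ltW.
have q0' : 0 < q%:R :> R by rewrite ltr0n.
have -> : 2 * c / A / t `^ beta = c * (2 / (A * t `^ beta)).
  by rewrite invfM !mulrA [c * 2]mulrC.
rewrite ler_wpM2l// -[2 / _]invf_div lef_pV2 ?posrE ?divr_gt0// ler_pdivrMr//.
have : q.+1%:R <= q%:R * 2 :> R by rewrite -natrM ler_nat muln2 -addnn -addn1 leq_add2l.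
by move/(lt_le_trans ltq)/ltW.
Qed.

(** * Second order expansion of the Lagrangian *)

Lemma trmx_continuous (R : realType) (m n : nat) :
  continuous (@trmx R m n).
Proof.
move=> M A /nbhs_ballP[e e0 MA]; apply/nbhs_ballP; exists e => // N MN.
case: MN => _ MN; apply: MA; split => // i j; rewrite !mxE; exact: MN.
Qed.

Lemma compact_cube (R : realType) (n : nat) (r : R) :
  compact [set v : 'cV[R]_n | forall i, `|v i 0| <= r].
Proof.
rewrite (_ : [set v | _] = trmx @`
    [set v : 'rV[R]_n | forall i, `[- r, r]%classic (v ord0 i)]).
  apply: continuous_compact; last first.
    by apply: (@rV_compact _ _ (fun=> `[- r, r]%classic)) => i; exact: segment_compact.
  by apply: continuous_subspaceT => x; exact: trmx_continuous.
apply/seteqP; split => [v vr|_ [v vr <-] i].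
  by exists v^T; rewrite ?trmxK// => i; rewrite mxE /= in_itv /= -ler_norml.
by rewrite mxE ler_norml; have := vr i; rewrite /= in_itv.
Qed.

Lemma Zperiodic_cube (R : realType) (n : nat) (V : zmodType)
    (g : 'cV[R]_n -> V) (x : 'cV[R]_n) :
  exists k : 'cV[int]_n, (forall i, `|(x - intvec R k) i 0| <= 1) /\
    (Zperiodic g -> g x = g (x - intvec R k)).
Proof.
exists (\col_i Num.floor (x i 0)); split => [i|gper].
  rewrite !mxE; have := floor_le_tmp (x i 0); have := floorD1_gt (x i 0).
  by rewrite intrD ler_norml => *; apply/andP; split; lra.
by rewrite -[in LHS](subrK (intvec R (\col_i Num.floor (x i 0))) x) gper.
Qed.

Lemma is_derive_line (R : realType) (V : normedModType R) (F : V -> R)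
    (z e : V) (t : R) : (forall y, differentiable F y) ->
  is_derive t 1 (fun s : R => F (z + s *: e)) ('D_e F (z + t *: e)).
Proof.
move=> dF; have FE : derivable F (z + t *: e) e by exact: diff_derivable.
rewrite /derivable in FE.
have E : (fun h : R => h^-1 *: ((fun s : R => F (z + s *: e)) (h *: 1 + t) - F (z + t *: e)))
   = (fun h : R => h^-1 *: (F (h *: e + (z + t *: e)) - F (z + t *: e))).
  apply/funext => h; congr (_ *: (F _ - _)); rewrite scalerDl addrCA.
  by congr (_ *: _ + _); exact: mulr1.
apply: DeriveDef; first by rewrite /derivable E.
by rewrite /derive E.
Qed.

Lemma derive_sum_dir (R : realType) (V : normedModType R) (F : V -> R)
    (n : nat) (c : 'I_n -> R) (e : 'I_n -> V) (a : V) : differentiable F a ->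
  'D_(\sum_i c i *: e i) F a = \sum_i c i * 'D_(e i) F a.
Proof.
move=> dF; rewrite deriveE// linear_sum; apply: eq_bigr => i _.
by rewrite linearZ /= deriveE.
Qed.

Lemma derive2_sum_dir (R : realType) (V : normedModType R) (F : V -> R)
    (n : nat) (c : 'I_n -> R) (e : 'I_n -> V) (a : V) : C2 F ->
  'D_(\sum_i c i *: e i) ('D_(\sum_i c i *: e i) F) a =
  \sum_i \sum_j c i * c j * 'D_(e j) ('D_(e i) F) a.
Proof.
move=> [[dF _] C1F].
have -> : 'D_(\sum_i c i *: e i) F = fun z => \sum_i c i * 'D_(e i) F z.
  by apply/funext => z; exact: derive_sum_dir.
pose u := \sum_i c i *: e i.
have : is_derive a u (fun z => \sum_i c i * 'D_(e i) F z)
    (\sum_i c i * 'D_u ('D_(e i) F) a).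
  apply: (@is_derive_bigsum _ _ _ _ _ (fun i z => c i * 'D_(e i) F z)
    (fun i z => c i * 'D_u ('D_(e i) F) z)) => i.
  apply: (@is_deriveZ _ _ _ ('D_(e i) F)).
  by apply: derivableP; apply: diff_derivable; exact: (C1F (e i)).1.
move=> -[_ ->]; apply: eq_bigr => i _; rewrite derive_sum_dir.
  by rewrite mulr_sumr; apply: eq_bigr => j _; rewrite mulrA.
exact: (C1F (e i)).1.
Qed.

Lemma cV_sum_delta (R : realType) (n : nat) (w : 'cV[R]_n) :
  w = \sum_i w i 0 *: delta_mx i 0.
Proof.
rewrite [LHS]matrix_sum_delta; apply: eq_bigr => i _.
by rewrite big_ord1.
Qed.

Lemma vertical_sum_delta (R : realType) (n : nat) (w : 'cV[R]_n) :
  (0 : 'cV[R]_n, w) = \sum_i w i 0 *: (0 : 'cV[R]_n, delta_mx i 0 : 'cV[R]_n).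
Proof.
rewrite {1}(cV_sum_delta w) (big_morph (fun v => (0 : 'cV[R]_n, v : 'cV[R]_n))
  (id1 := 0) (op1 := +%R)) //; last first.
  by move=> x y; congr pair; rewrite addr0.
by apply: eq_bigr => i _; congr pair; rewrite scaler0.
Qed.

(** Smoothness is assumed jointly in [(x, v)]; derivatives in [v] alone are read as joint
    derivatives along [(0, w)]. *)
Lemma derive_vertical (R : realType) (n : nat) (L : 'cV[R]_n -> 'cV[R]_n -> R)
    (x v w : 'cV[R]_n) :
  'D_w (L x) v = 'D_((0 : 'cV[R]_n, w)) (fun z : 'cV[R]_n * 'cV[R]_n => L z.1 z.2) (x, v).
Proof.
pose F z : R := L z.1 z.2.
have E : (fun h : R => h^-1 *: (L x (h *: w + v) - L x v)) =
    (fun h : R => h^-1 *: (F (h *: (0 : 'cV[R]_n, w) + (x, v)) - F (x, v))).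
  by apply/funext => h; rewrite /F /= scaler0 add0r.
by rewrite /derive /= E.
Qed.

Lemma hessianE (R : realType) (n : nat) (L : 'cV[R]_n -> 'cV[R]_n -> R)
    (x v : 'cV[R]_n) (i j : 'I_n) :
  hessian (L x) v i j =
    'D_((0 : 'cV[R]_n, delta_mx j 0 : 'cV[R]_n))
      ('D_((0 : 'cV[R]_n, delta_mx i 0 : 'cV[R]_n))
        (fun z : 'cV[R]_n * 'cV[R]_n => L z.1 z.2)) (x, v).
Proof.
rewrite mxE; pose G := 'D_((0 : 'cV[R]_n, delta_mx i 0 : 'cV[R]_n))
  (fun z : 'cV[R]_n * 'cV[R]_n => L z.1 z.2).
have -> : 'D_(delta_mx i 0) (L x) = fun v => G (x, v).
  by apply/funext => y; rewrite derive_vertical.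
rewrite (derive_vertical (fun x v => G (x, v))).
by congr ('D_(_) _ _); apply/funext => -[].
Qed.

Lemma derive2_vertical (R : realType) (n : nat) (L : 'cV[R]_n -> 'cV[R]_n -> R)
    (x v w : 'cV[R]_n) (F := fun z : 'cV[R]_n * 'cV[R]_n => L z.1 z.2) : C2 F ->
  'D_((0 : 'cV[R]_n, w)) ('D_((0 : 'cV[R]_n, w)) F) (x, v) =
  dot (hessian (L x) v *m w) w.
Proof.
move=> C2F; rewrite vertical_sum_delta derive2_sum_dir//.
rewrite /dot; apply: eq_bigr => i _; rewrite mxE mulr_suml.
by apply: eq_bigr => j _; rewrite hessianE; ring.
Qed.

Section Lagrangian.
Variables (R : realType) (n : nat) (L : 'cV[R]_n -> 'cV[R]_n -> R).
Variable omega : 'cV[R]_n.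
Hypothesis C2L : C2 (fun z : 'cV[R]_n * 'cV[R]_n => L z.1 z.2).

Lemma vertical_line (x v w : 'cV[R]_n) (t : R) :
  (x, v) + t *: (0 : 'cV[R]_n, w) = (x, v + t *: w).
Proof. by congr pair; rewrite /= scaler0 addr0. Qed.

Lemma is_derive_vertical (x v w : 'cV[R]_n) (t : R) :
  is_derive t 1 (fun s : R => L x (v + s *: w)) ('D_w (L x) (v + t *: w)).
Proof.
have := is_derive_line (x, v) (0 : 'cV[R]_n, w) t C2L.1.1.
rewrite vertical_line -derive_vertical; congr is_derive.
by apply/funext => s; rewrite vertical_line.
Qed.

Lemma is_derive2_vertical (x v w : 'cV[R]_n) (t : R) :
  is_derive t 1 (fun s : R => 'D_w (L x) (v + s *: w))
    (dot (hessian (L x) (v + t *: w) *m w) w).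
Proof.
have := is_derive_line (x, v) (0 : 'cV[R]_n, w) t (C2L.2 (0 : 'cV[R]_n, w)).1.
rewrite vertical_line derive2_vertical//; congr is_derive.
by apply/funext => s; rewrite vertical_line -derive_vertical.
Qed.

Hypothesis L0 : forall x, L x omega = 0.
Hypothesis dL0 : forall x w, 'D_w (L x) omega = 0.

(** The mean value theorem is applied to [L] along the segment from [omega], then to its derivative.
    The unspecified factor [c] in [[0, 1]] replaces 1/2, which is enough for both the sign and the
    quadratic bound. *)
Lemma vertical_taylor (x w : 'cV[R]_n) : exists c e : R,
  [/\ 0 <= c <= 1, 0 <= e <= 1 &
  L x (omega + w) = c * dot (hessian (L x) (omega + e *: w) *m w) w].
Proof.
have [c /andP[c0 c1]] := MVT_is_derive ltr01 (is_derive_vertical x omega w).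
rewrite scale1r scale0r addr0 L0 !subr0 mulr1 => ->.
have [e /andP[e0 ec]] := MVT_is_derive c0 (is_derive2_vertical x omega w).
rewrite scale0r addr0 dL0 !subr0 => ->; exists c, e; split; last by rewrite mulrC.
  by rewrite !ltW.
by apply/andP; split; lra.
Qed.

Lemma lagrangian_ge0 (x v : 'cV[R]_n) : positive_definite L -> 0 <= L x v.
Proof.
move=> Lpos; rewrite -(subrK omega v) addrC.
have [c [e [/andP[c0 _] _ ->]]] := vertical_taylor x (v - omega).
rewrite mulr_ge0//; have [->|w0] := eqVneq (v - omega) 0.
  by rewrite mulmx0 /dot big1// => i _; rewrite mxE mul0r.
exact/ltW/Lpos.
Qed.

(** By periodicity [x] may be taken in a cube, and [v] stays within [B] of [omega] in each
    coordinate; on this compact set the continuous Hessian is bounded. *)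
Lemma lagrangian_le (B : R) : Zperiodic L ->
  exists2 C : R, 0 <= C & forall (x w : 'cV[R]_n) (r : R), r <= B ->
    (forall i, `|w i 0| <= r) -> L x (omega + w) <= C * r ^+ 2.
Proof.
move=> Lper; pose B' := B + \sum_i `|omega i 0|.
pose K := [set x : 'cV[R]_n | forall i, `|x i 0| <= 1] `*`
          [set v : 'cV[R]_n | forall i, `|v i 0| <= B'].
have cK : compact K by apply: compact_setX; exact: compact_cube.
have /choice[M MP] (ij : 'I_n * 'I_n) : exists M : R, forall x v, K (x, v) ->
    `|hessian (L x) v ij.1 ij.2| <= M.
  have cont := (C2L.2 (0 : 'cV[R]_n, delta_mx ij.1 0 : 'cV[R]_n)).2
    (0 : 'cV[R]_n, delta_mx ij.2 0 : 'cV[R]_n).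
  have /compact_bounded[M [_ MM]] :=
    continuous_compact (continuous_subspaceT cont) cK.
  exists (M + 1) => x v Kxv; rewrite hessianE; apply: (MM (M + 1)); first by rewrite ltrDl.
  by exists (x, v).
exists (\sum_i \sum_j `|M (i, j)|) => [|x w r rB wr].
  by apply: sumr_ge0 => i _; apply: sumr_ge0.
have [k [xk]] := Zperiodic_cube L x; move=> /(_ Lper) ->.
move: (x - _) xk => {}x x1.
have [c [e [cI eI ->]]] := vertical_taylor x w.
have Kx : K (x, omega + e *: w).
  split => //= i; rewrite !mxE (le_trans (ler_normD _ _))// addrC lerD//.
    rewrite normrM ger0_norm; last by case/andP: eI.
    apply: le_trans rB; apply: le_trans (wr i).
    by rewrite ler_piMl//; case/andP: eI.
  by rewrite (bigD1 i)//= lerDl sumr_ge0.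
have hle : `|dot (hessian (L x) (omega + e *: w) *m w) w| <=
    \sum_i \sum_j `|M (i, j)| * r ^+ 2.
  apply: (le_trans (ler_norm_sum _ _ _)); apply: ler_sum => i _.
  rewrite mxE mulr_suml; apply: (le_trans (ler_norm_sum _ _ _)).
  apply: ler_sum => j _; rewrite !normrM -mulrA expr2.
  rewrite ler_pM ?mulr_ge0//; last exact: ler_pM.
  exact: le_trans (MP (i, j) _ _ Kx) (ler_norm _).
apply: (le_trans (ler_norm _)); rewrite normrM ger0_norm; last by case/andP: cI.
apply: (@le_trans _ _ `|dot (hessian (L x) (omega + e *: w) *m w) w|).
  by rewrite ler_piMl//; case/andP: cI.
apply: (le_trans hle); rewrite mulr_suml; apply: ler_sum => i _.
by rewrite mulr_suml.
Qed.
End Lagrangian.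

(** * Vanishing of the Lagrangian and of its first derivative at [omega] *)

Lemma dotZ (R : realType) (n : nat) (c : R) (v : 'cV[R]_n) :
  dot (c *: v) (c *: v) = c ^+ 2 * dot v v.
Proof. by rewrite /dot mulr_sumr; apply: eq_bigr => i _; rewrite !mxE; ring. Qed.

Lemma enormZ (R : realType) (n : nat) (c : R) (v : 'cV[R]_n) :
  enorm (c *: v) = `|c| * enorm v.
Proof. by rewrite /enorm dotZ sqrtrM ?sqr_ge0// sqrtr_sqr. Qed.

Lemma enorm_ge0 (R : realType) (n : nat) (v : 'cV[R]_n) : 0 <= enorm v.
Proof. exact: sqrtr_ge0. Qed.

Section LagrangianAtOmega.
Variables (R : realType) (n : nat) (A : 'cV[R]_n -> 'M[R]_n).
Variables (f : 'cV[R]_n -> 'cV[R]_n -> R) (omega : 'cV[R]_n).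
Hypothesis f_bigO : forall x, (f x : 'cV[R]_n -> R^o)
       =O_ (0 : 'cV[R]_n) (fun w => enorm w ^+ 3 : R^o).

Lemma lagrangian_near (x : 'cV[R]_n) : exists2 k : R, 0 < k &
  \forall w \near (0 : 'cV[R]_n), `|f x w| <= k * enorm w ^+ 3.
Proof.
have /eqO_exP[k k0 kP] := f_bigO x; exists k => //.
apply: filterS kP => w; rewrite [X in _ * X]ger0_norm//.
by rewrite exprn_ge0// enorm_ge0.
Qed.

(** The cubic bound holds on a neighbourhood of 0, hence at 0 itself, where it forces
    [f x 0 = 0]. *)
Lemma lagrangian_omega (x : 'cV[R]_n) : lagrangian A f omega x omega = 0.
Proof.
have [k k0 /nbhs_singleton] := lagrangian_near x.
rewrite -(scale0r (0 : 'cV[R]_n)) enormZ normr0 mul0r expr0n /= mulr0 normr_le0.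
rewrite scale0r => /eqP f0.
rewrite /lagrangian subrr f0 mulmx0 addr0 /dot big1 ?mulr0// => i _.
by rewrite mxE mul0r.
Qed.

(** Along [omega + h w] with [|h| <= 1] both the quadratic part and the cubic remainder are
    [O(h^2)], so the difference quotient tends to 0. *)
Lemma derive_lagrangian_omega (x w : 'cV[R]_n) :
  differentiable (lagrangian A f omega x) omega ->
  'D_w (lagrangian A f omega x) omega = 0.
Proof.
move=> dL; have [k k0 kP] := lagrangian_near x.
pose C : R := `|2^-1 * dot (A x *m w) w| + k * enorm w ^+ 3.
have C0 : 0 <= C by rewrite addr_ge0// mulr_ge0 ?exprn_ge0 ?enorm_ge0 ?ltW.
have key : \forall h \near (0 : R),
    `|lagrangian A f omega x (h *: w + omega)| <= C * h ^+ 2.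
  have h1 : \forall h \near (0 : R), `|f x (h *: w)| <= k * enorm (h *: w) ^+ 3.
    have sw : (fun h : R => h *: w) @ (0 : R) --> (0 : 'cV[R]_n).
      by rewrite -[X in _ --> X](scale0r w); exact: scalel_continuous.
    exact: (sw _ kP).
  have h2 : \forall h \near (0 : R), `|h| <= 1.
    exact: (@nbhs0_le _ R^o).
  near=> h.
  have hf : `|f x (h *: w)| <= k * enorm (h *: w) ^+ 3 by near: h.
  have h3 : `|h| <= 1 by near: h.
  rewrite /lagrangian addrK.
  have -> : 2^-1 * dot (A x *m (h *: w)) (h *: w) = h ^+ 2 * (2^-1 * dot (A x *m w) w).
    rewrite -scalemxAr /dot !mulr_sumr; apply: eq_bigr => i _.
    by rewrite !mxE; ring.
  apply: (le_trans (ler_normD _ _)); rewrite /C mulrDl lerD//.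
    by rewrite normrM (ger0_norm (sqr_ge0 h)) mulrC.
  apply: (le_trans hf); rewrite enormZ.
  have -> : k * (`|h| * enorm w) ^+ 3 = k * enorm w ^+ 3 * `|h| ^+ 3 by ring.
  rewrite ler_wpM2l ?mulr_ge0 ?exprn_ge0 ?enorm_ge0 ?(ltW k0)//.
  by rewrite -(real_normK (num_real h)) exprS ler_piMl.
have dw : derivable (lagrangian A f omega x) omega w by exact: diff_derivable.
apply: (cvg_unique _ dw); first exact: Rhausdorff.
apply/cvgr0Pnorm_le => e e0.
have e1 : \forall h \near (0 : R), `|h| <= e / (C + 1).
  by apply: (@nbhs0_le _ R^o); rewrite divr_gt0//; lra.
near=> h.
have h0 : h != 0 by near: h; exact: nbhs_dnbhs_neq.
have keyh : `|lagrangian A f omega x (h *: w + omega)| <= C * h ^+ 2.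
  by near: h; exact: nbhs_dnbhs.
have eh : `|h| <= e / (C + 1) by near: h; exact: nbhs_dnbhs.
rewrite /= lagrangian_omega subr0 normrM normfV.
have hn : 0 < `|h| by rewrite normr_gt0.
rewrite mulrC ler_pdivrMr//; apply: (le_trans keyh).
rewrite -(real_normK (num_real h)) expr2 mulrA ler_pM2r//.
move: eh; rewrite ler_pdivlMr; last lra.
by rewrite mulrDr mulr1 mulrC; have := normr_ge0 h; lra.
Unshelve. all: by end_near. Qed.
End LagrangianAtOmega.

(** * Action of straight paths *)

Lemma cvg_uniformP (R : realType) (T : choiceType) (G : R -> T -> R)
    (g : T -> R) :
  {uniform, G t @[t --> +oo] --> g} <->
  forall e, 0 < e -> \forall t \near +oo, forall x, `|g x - G t x| < e.
Proof.
split=> [Gg e e0|Gg].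
  have := Gg [set h | forall x, ball (g x) e (h x)]; apply.
  apply/uniform_nbhs; exists [set xy | ball xy.1 e xy.2]; split.
    by rewrite -entourage_ballE; exists e.
  by move=> h /= gh x; exact: gh.
move=> P /uniform_nbhs[E [entE EP]].
move: entE; rewrite -entourage_ballE => -[e /= e0 eE].
apply: filterS (Gg e e0) => t tP; apply: EP => x _; apply: eE; exact: tP.
Qed.

Section Action.
Variables (R : realType) (n : nat) (L : 'cV[R]_n -> 'cV[R]_n -> R).

Lemma action_ge0 (t : R) (g : R -> 'cV[R]_n) : (forall x v, 0 <= L x v) ->
  0 <= action L t g.
Proof. by move=> L0; apply: Rintegral_ge0 => s _. Qed.

Definition straight (t : R) (x v : 'cV[R]_n) (s : R) : 'cV[R]_n :=
  x - (t - s) *: v.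

Lemma is_derive_straight (t s : R) (x v : 'cV[R]_n) :
  is_derive s 1 (straight t x v) v.
Proof.
have -> : straight t x v = cst (x - t *: v) + (fun s => s *: v).
  by apply/funext => r; rewrite /straight fctE scalerBl opprB addrA addrAC.
have dv : is_derive s 1 (fun s : R => s *: v) v.
  have E : (fun h : R => h^-1 *: ((h *: 1 + s) *: v - s *: v)) @ 0^' --> v.
    apply: (@cvg_trans _ ((fun=> v) @ (0 : R)^')); last exact: cvg_cst.
    apply: near_eq_cvg; near=> h.
    have h0 : h != 0 by near: h; exact: nbhs_dnbhs_neq.
    by rewrite -scalerBl addrK scalerA [h *: 1]mulr1 mulVf// scale1r.
  apply: DeriveDef; first by apply/cvg_ex; exists v.
  by apply/cvg_lim => //; exact: norm_hausdorff.
rewrite -[X in is_derive _ _ _ X]add0r.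
exact: is_deriveD.
Unshelve. all: by end_near. Qed.

Lemma derive1_straight (t s : R) (x v : 'cV[R]_n) :
  derive1 (straight t x v) s = v.
Proof. by rewrite derive1E; case: (is_derive_straight t s x v). Qed.

Lemma straight_continuous (t : R) (x v : 'cV[R]_n) : continuous (straight t x v).
Proof.
move=> s; apply: differentiable_continuous; apply/derivable1_diffP.
by case: (is_derive_straight t s x v).
Qed.

Lemma straight_admissible (t : R) (x v : 'cV[R]_n) : 0 < t ->
  admissible t x (straight t x v).
Proof.
move=> t0; split.
- by apply: continuous_subspaceT; exact: straight_continuous.
- exists [:: t]; first by split; rewrite /= ?t0//.
  case=> //= _; exists (straight t x v); split => //.
    by move=> s; case: (is_derive_straight t s x v).
  rewrite (_ : derive1 _ = cst v); first exact: cst_continuous.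
  by apply/funext => s; exact: derive1_straight.
- by rewrite /straight subrr scale0r subr0.
Qed.

Hypothesis L_cont : continuous (fun z : 'cV[R]_n * 'cV[R]_n => L z.1 z.2).
Hypothesis L_ge0 : forall x v, 0 <= L x v.

Lemma action_straight_le (t M : R) (x v : 'cV[R]_n) : 0 < t ->
  (forall y, L y v <= M) -> action L t (straight t x v) <= t * M.
Proof.
move=> t0 LM; rewrite /action.
rewrite (_ : (fun s => L _ _) = fun s => L (straight t x v s) v); last first.
  by apply/funext => s; rewrite derive1_straight.
have -> : t * M = \int[lebesgue_measure]_(s in `[0, t]) M.
  have mut : lebesgue_measure `[0, t]%classic = t%:E.
    by rewrite lebesgue_measure_itv /= lte_fin t0 sube0.
  rewrite Rintegral_cst; last exact: measurable_itv.
  by rewrite mulrC -[t in LHS]/(fine t%:E) -mut.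
have Lv_cont : continuous (fun s => L (straight t x v s) v).
  move=> s; have := @cvg_comp _ _ _ (fun s => (straight t x v s, v))
    (fun z : 'cV[R]_n * 'cV[R]_n => L z.1 z.2) _ _ _ _ (@L_cont (straight t x v s, v)).
  apply; apply: (@cvg_pair _ _ _ _ (nbhs (straight t x v s)) (nbhs v)).
    exact: straight_continuous.
  exact: cvg_cst.
apply: le_Rintegral => //.
- apply: continuous_compact_integrable; first exact: segment_compact.
  by apply: continuous_subspaceT; exact: Lv_cont.
- apply: continuous_compact_integrable; first exact: segment_compact.
  by apply: continuous_subspaceT; exact: cst_continuous.
Qed.

Variables (u : 'cV[R]_n -> R) (m : R).
Hypothesis u_ge : forall y, m <= u y.

(** Nonnegativity of the action bounds all costs below, without which the real-valued [inf] could
    not be compared with its members. *)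
Lemma cost_ge (t : R) (x : 'cV[R]_n) :
  lbound [set u (g 0) + action L t g | g in admissible t x] m.
Proof.
by move=> _ [g _ <-]; rewrite -[m]addr0 lerD// action_ge0.
Qed.

Lemma LaxOleinik_ge (t : R) (x : 'cV[R]_n) : 0 < t -> m <= LaxOleinik L u t x.
Proof.
move=> t0; apply: lb_le_inf; last exact: cost_ge.
(* The stationary path shows that the infimum is over a nonempty set. *)
by exists (u (straight t x 0 0) + action L t (straight t x 0)), (straight t x 0);
  first exact: straight_admissible.
Qed.

Lemma LaxOleinik_le (t M : R) (x v : 'cV[R]_n) : 0 < t ->
  (forall y, L y v <= M) -> LaxOleinik L u t x <= u (x - t *: v) + t * M.
Proof.
move=> t0 LM; apply: (@le_trans _ _
    (u (straight t x v 0) + action L t (straight t x v))).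
  apply: ge_inf; first by exists m; exact: cost_ge.
  by exists (straight t x v); first exact: straight_admissible.
by rewrite {1}/straight subr0 lerD2l action_straight_le.
Qed.

Lemma newLaxOleinik_ge (t : R) (x : 'cV[R]_n) : 0 < t ->
  m <= newLaxOleinik L u t x.
Proof.
move=> t0; apply: lb_le_inf.
  by exists (LaxOleinik L u t x), t => //=; rewrite in_itv /= lexx; lra.
move=> _ [s /= + <-]; rewrite in_itv /= => /andP[ts _].
by apply: LaxOleinik_ge; lra.
Qed.

Lemma newLaxOleinik_le (t s : R) (x : 'cV[R]_n) : 0 < t -> t <= s <= 2 * t ->
  newLaxOleinik L u t x <= LaxOleinik L u s x.
Proof.
move=> t0 sI; apply: ge_inf; last by exists s => //=; rewrite in_itv.
exists m => _ [r /= + <-]; rewrite in_itv /= => /andP[tr _].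
by apply: LaxOleinik_ge; lra.
Qed.
End Action.

(** * Rate of convergence *)

Lemma periodic_extrema (R : realType) (n : nat) (u : 'cV[R]_n -> R) :
  continuous u -> Zperiodic u ->
  exists y z, forall x, u y <= u x <= u z.
Proof.
move=> u_cont u_per; pose K := [set x : 'cV[R]_n | forall i, `|x i 0| <= 1].
have cK : compact K by exact: compact_cube.
have K0 : K !=set0 by exists 0 => i; rewrite mxE normr0.
have uK : {within K, continuous u} by exact: continuous_subspaceT.
have [y _ yP] := compact_EVT_min K0 cK uK.
have [z _ zP] := compact_EVT_max K0 cK uK.
exists y, z => x; have [k [xk ->//]] := Zperiodic_cube u x.
by rewrite yP ?zP// inE.
Qed.

(** This transfers the quadratic bound from one frequency to all others with the same constant. *)
Lemma lagrangian_shift (R : realType) (n : nat) (A : 'cV[R]_n -> 'M[R]_n)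
    (f : 'cV[R]_n -> 'cV[R]_n -> R) (omega omega' x w : 'cV[R]_n) :
  lagrangian A f omega x (omega + w) = lagrangian A f omega' x (omega' + w).
Proof. by rewrite /lagrangian ![_ + w]addrC !addrK. Qed.

Lemma lagrangian_periodic (R : realType) (n : nat) (A : 'cV[R]_n -> 'M[R]_n)
    (f : 'cV[R]_n -> 'cV[R]_n -> R) (omega : 'cV[R]_n) :
  Zperiodic A -> (forall w, Zperiodic (f ^~ w)) ->
  Zperiodic (lagrangian A f omega).
Proof.
move=> A_per f_per k x; apply/funext => v; rewrite /lagrangian A_per.
by congr (_ + _); exact: (f_per (v - omega) k x).
Qed.

Section Convergence.
Variables (R : realType) (n : nat) (L : 'cV[R]_n -> 'cV[R]_n -> R).
Variables (omega : 'cV[R]_n) (u : 'cV[R]_n -> R) (y : 'cV[R]_n) (B C : R).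
Hypothesis L_cont : continuous (fun z : 'cV[R]_n * 'cV[R]_n => L z.1 z.2).
Hypothesis L_ge0 : forall x v, 0 <= L x v.
Hypothesis L_le : forall (x w : 'cV[R]_n) (r : R), r <= B ->
  (forall i, `|w i 0| <= r) -> L x (omega + w) <= C * r ^+ 2.
Hypothesis u_per : Zperiodic u.
Hypothesis u_ge : forall x, u y <= u x.

Lemma LaxOleinik_lattice (s r : R) (x : 'cV[R]_n) (k : 'cV[int]_n) :
  0 < s -> r / s <= B ->
  (forall i, `|x i 0 - y i 0 - s * omega i 0 - (k i 0)%:~R| <= r) ->
  LaxOleinik L u s x <= u y + C * r ^+ 2 / s.
Proof.
move=> s0 rB xk.
(* With velocity [omega + w] the straight path leaves from [y + k] and reaches [x] at time [s]; its
   cost is at most [s C (r / s)^2]. *)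
pose w := s^-1 *: (x - y - s *: omega - intvec R k).
have wr i : `|w i 0| <= r / s.
  rewrite !mxE normrM ger0_norm ?invr_ge0 ?(ltW s0)// mulrC.
  by rewrite ler_pM2r ?invr_gt0.
have := LaxOleinik_le L_cont L_ge0 u_ge x s0 (fun z => L_le z rB wr).
have -> : x - s *: (omega + w) = y + intvec R k.
  rewrite scalerDr scalerA divff ?gt_eqF// scale1r.
  by apply/matrixP => i j; rewrite !mxE; ring.
rewrite u_per (_ : s * _ = C * r ^+ 2 / s)//.
by field; rewrite gt_eqF.
Qed.

(** Rounding bounds each coordinate of [delta] by 1 at every time, so the semigroup lies between
    [u y] and [u y + C / t]; [1 <= B] admits the radius [1 / t] once [t > 1]. *)
Lemma ubarE : 1 <= B -> 0 <= C -> ubar L u = cst (u y).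
Proof.
move=> B1 C0.
have cvg_uy : {uniform, LaxOleinik L u t @[t --> +oo] --> cst (u y)}.
  apply/cvg_uniformP => e e0; near=> t.
  have t1 : 1 < t by near: t; apply: nbhs_pinfty_gt; exact: num_real.
  have tC : C / e < t by near: t; apply: nbhs_pinfty_gt; exact: num_real.
  have t0 : 0 < t by lra.
  move=> x; rewrite distrC ger0_norm; last by rewrite subr_ge0; exact: LaxOleinik_ge.
  pose k := \col_i Num.floor (x i 0 - y i 0 - t * omega i 0 + 2^-1).
  have kP i : `|x i 0 - y i 0 - t * omega i 0 - (k i 0)%:~R| <= 1.
    rewrite mxE; set p := x i 0 - _ - _; set q := Num.floor _.
    have := floor_le_tmp (p + 2^-1); have := floorD1_gt (p + 2^-1).
    by rewrite intrD ler_norml -/q => *; apply/andP; split; lra.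
  have t1B : 1 / t <= B by rewrite ler_pdivrMr//; nra.
  have := LaxOleinik_lattice t0 t1B kP; rewrite expr1n mulr1.
  have : C / t < e by rewrite ltr_pdivrMr// mulrC -ltr_pdivrMr.
  by rewrite /=; lra.
(* [get] returns a uniform limit because one exists; the triangle inequality then identifies the two
   limits. *)
have /cvg_uniformP cvg_ubar : {uniform, LaxOleinik L u t @[t --> +oo] --> ubar L u}.
  by apply: (@getPex _ (fun ub : 'cV[R]_n -> R =>
    {uniform, LaxOleinik L u t @[t --> +oo] --> ub})); exists (cst (u y)).
move/cvg_uniformP in cvg_uy.
apply/funext => x; apply/eqP; rewrite -subr_eq0 -normr_le0.
apply/ler_addgt0Pl => e e0; rewrite addr0.
have e2 : 0 < e / 2 by rewrite divr_gt0.
near (pinfty_nbhs R) => t.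
have h1 : `|ubar L u x - LaxOleinik L u t x| < e / 2.
  by move: x; near: t; exact: cvg_ubar.
have h2 : `|cst (u y) x - LaxOleinik L u t x| < e / 2.
  by move: x {h1}; near: t; exact: cvg_uy.
have := ler_distD (LaxOleinik L u t x) (ubar L u x) (cst (u y) x).
by rewrite [`|LaxOleinik _ _ _ _ - _|]distrC; lra.
Unshelve. all: by end_near. Qed.

End Convergence.

Unset Implicit Arguments.
Set Strict Implicit.
Set Printing Implicit Defensive.

Theorem theorem1p6 (R : realType) (n : nat) (n_gt0 : (0 < n)%N)
    (rho alpha : R) (rho_gt : n%:R - 1 < rho) (alpha_gt0 : 0 < alpha)
    (A : 'cV[R]_n -> 'M[R]_n) (f : 'cV[R]_n -> 'cV[R]_n -> R)
    (A_per : Zperiodic A) (f_per : forall w, Zperiodic (f ^~ w))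
    (f_bigO : forall x, (f x : 'cV[R]_n -> R^o)
       =O_ (0 : 'cV[R]_n) (fun w => enorm w ^+ 3 : R^o))
    (u : 'cV[R]_n -> R) (u_cont : continuous u) (u_per : Zperiodic u) :
  exists2 K : R, 0 < K &
    forall omega : 'cV[R]_n, Diophantine n rho alpha omega ->
      C2 (fun z : 'cV[R]_n * 'cV[R]_n => lagrangian A f omega z.1 z.2) ->
      positive_definite (lagrangian A f omega) ->
      superlinear (lagrangian A f omega) ->
      forall t : R, 0 < t ->
        (supnorm (newLaxOleinik (lagrangian A f omega) u t
                  \- ubar (lagrangian A f omega) u)%R
         <= (K * t `^ (- (1 + 4 / (2 * rho + n%:R))))%:E)%E.
Proof.
(* The constant must precede [omega]: it is computed from an auxiliary [omega0] giving a C^2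
   Lagrangian. If there is none, the claim is vacuous. *)
have [[omega0 C2L0]|none] := pselect (exists omega : 'cV[R]_n,
    C2 (fun z : 'cV[R]_n * 'cV[R]_n => lagrangian A f omega z.1 z.2)); last first.
  by exists 1 => // omega _ C2L; case: none; exists omega.
have [y [z yz]] := periodic_extrema u_cont u_per.
have u_ge x : u y <= u x by have /andP[] := yz x.
have u_le x : u x <= u z by have /andP[] := yz x.
have L0 omega x : lagrangian A f omega x omega = 0 by exact: lagrangian_omega.
have Ldiff omega x :
    C2 (fun z : 'cV[R]_n * 'cV[R]_n => lagrangian A f omega z.1 z.2) ->
    differentiable (lagrangian A f omega x) omega.
  move=> -[[dF _] _].
  apply: (@differentiable_comp _ _ _ _ (fun v => (x, v))
    (fun z : 'cV[R]_n * 'cV[R]_n => lagrangian A f omega z.1 z.2)) => //.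
have dL0 omega x w :
    C2 (fun z : 'cV[R]_n * 'cV[R]_n => lagrangian A f omega z.1 z.2) ->
    'D_w (lagrangian A f omega x) omega = 0.
  by move=> C2L; apply: derive_lagrangian_omega => //; exact: Ldiff.
have [C1 C10 dense] := flow_dense n_gt0 rho_gt alpha_gt0.
(* The radius [C1 + 1] covers the deviations of velocity, at most [C1] for [t >= 1], and is at least
   1 as [ubarE] demands. *)
have [C C0 L_le0] := lagrangian_le C2L0 (L0 omega0)
  (fun x w => dL0 omega0 x w C2L0) (C1 + 1) (lagrangian_periodic omega0 A_per f_per).
have L_le omega (x w : 'cV[R]_n) (r : R) : r <= C1 + 1 ->
    (forall i, `|w i 0| <= r) -> lagrangian A f omega x (omega + w) <= C * r ^+ 2.
  by rewrite (lagrangian_shift _ _ omega omega0); exact: L_le0.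
have K0 : 0 <= C * C1 ^+ 2 by rewrite mulr_ge0 ?exprn_ge0 ?(ltW C10).
have uyz := u_ge z.
(* The first summand serves for [t >= 1], the oscillation of [u] for [t < 1], and the 1 ensures
   positivity. *)
exists (C * C1 ^+ 2 + (u z - u y) + 1); first lra.
move=> omega dioph C2L Lpos _ t t0.
set L := lagrangian A f omega.
have L_cont : continuous (fun z : 'cV[R]_n * 'cV[R]_n => L z.1 z.2).
  by move=> p; apply: differentiable_continuous; exact: C2L.1.1.
have L_ge0 x v : 0 <= L x v.
  exact: (lagrangian_ge0 C2L (L0 omega) (fun x w => dL0 omega x w C2L)).
rewrite (ubarE L_cont L_ge0 (L_le omega) u_per u_ge)//; last lra.
apply: ge_ereal_sup => _ [x _ <-]; rewrite lee_fin /=.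
rewrite ger0_norm; last by rewrite subr_ge0; exact: newLaxOleinik_ge.
set gamma := 1 + _.
have n0 : 0 < n%:R :> R by rewrite ltr0n.
have n1 : 1 <= n%:R :> R by rewrite ler1n.
have gamma0 : 0 <= gamma by rewrite addr_ge0// divr_ge0//; lra.
(* For [t < 1] the path of velocity [omega] has zero action, so the error is at most the oscillation
   of [u], while [t^(-gamma) >= 1]. *)
have [t1|t1] := ltP t 1.
  have tg : 1 <= t `^ (- gamma).
    by rewrite -[leLHS](powRr0 t) ger_powR ?t0 ?(ltW t1)// oppr_le0.
  apply: (@le_trans _ _ (u z - u y)); last by nra.
  rewrite lerD2r; apply: le_trans (newLaxOleinik_le L_ge0 u_ge (s := t) x t0 _) _.
    by apply/andP; split; lra.
  apply: le_trans (LaxOleinik_le L_cont L_ge0 u_ge (M := 0) (v := omega) x t0 _) _.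
    by move=> p; rewrite /L L0.
  by rewrite mulr0 addr0.
have [s /andP[ts s2t] [k xk]] := dense _ dioph (x - y) _ t1.
set beta := 2 / _ in xk; have s0 : 0 < s by lra.
have beta0 : 0 <= beta by rewrite divr_ge0//; lra.
have tb1 : t `^ (- beta) <= 1 by rewrite -[leRHS](powRr0 t) ler_powR// oppr_le0.
have tb0 : 0 <= t `^ (- beta) by exact: powR_ge0.
have rB : C1 * t `^ (- beta) / s <= C1 + 1 by rewrite ler_pdivrMr//; nra.
have xk' i : `|x i 0 - y i 0 - s * omega i 0 - (k i 0)%:~R| <= C1 * t `^ (- beta).
  by have := xk i; rewrite !mxE.
have LO := LaxOleinik_lattice L_cont L_ge0 (L_le omega) u_per u_ge s0 rB xk'.
rewrite lerBlDl; apply: le_trans (newLaxOleinik_le L_ge0 u_ge x t0 _) _.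
  by apply/andP; split; [exact: ts|exact: s2t].
apply: (le_trans LO); rewrite lerD2l.
(* Here [gamma = 1 + 2 beta]: the cost is quadratic in the distance [t^(-beta)] and inversely
   proportional to the duration. *)
have -> : t `^ (- gamma) = (t `^ (- beta)) ^+ 2 / t.
  rewrite -powR_mulrn// -powRrM /gamma opprD addrC powRD ?(gt_eqF t0) ?implybT//.
  rewrite powR_inv1 ?(ltW t0)//; congr (_ `^ _ / _); rewrite /beta; field.
  by rewrite gt_eqF//; lra.
apply: (@le_trans _ _ (C * C1 ^+ 2 * ((t `^ (- beta)) ^+ 2 / t))).
  rewrite exprMn !mulrA ler_wpM2l ?lef_pV2 ?posrE//.
  by rewrite !mulr_ge0 ?exprn_ge0 ?(ltW C10).
rewrite ler_wpM2r ?divr_ge0 ?exprn_ge0 ?(ltW t0)//; lra.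
Qed.
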